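(* Let $\mathcal L$ be a language containing a binary predicate $<$ and let $T$ be a complete $\mathcal L$-theory all of whose models are $*$-locally weakly o-minimal structures with the univariate $*$-continuity property. Let $\mathcal M=(M,\ldots)$ be a model of $T$, $A\subseteq M$, and $X\subseteq M^n$ a set definable over $A$. Then $\dim X=\operatorname{rk}_T^{\operatorname{discl}}(X/A)$. In particular, $\operatorname{rk}_T^{\operatorname{discl}}(X/A)$ does not depend on the parameter set $A$ over which $X$ is definable.
   Context: Structures are expansions of dense linear orders without endpoints; ''definable'' means with parameters; order and product topologies. $\overline M=M\cup\{\text{definable gaps}\}$ (a definable gap: pair $(A,B)$ of nonempty definable subsets of $M$ with $M=A\cup B$, $A<B$, $A$ without maximum, $B$ without minimum), naturally ordered; $\overline I=\{x\in\overline M:b_1<x<b_2\}$ for $I=(b_1,b_2)$. $*$-locally weakly o-minimal: for every definable $X\subseteq M$ and $\bar a\in\overline M$ there is an open interval $I$ with $\bar a\in\overline I$ and $X\cap I$ a union of a finite set and finitely many open convex sets. A definable function into $\overline M$ is one of the form $x\mapsto\sup Y_x$ for definable $Y$. Univariate $*$-continuity property: every definable $f:I\to\overline M$ on a nonempty open interval is continuous on some nonempty open subinterval. For a structure $\mathcal N$ and $B\subseteq N$, $\operatorname{discl}_{\mathcal N}(B)$ is the set of $x\in N$ lying in some discrete closed set defined by an $\mathcal L(B)$-formula; this gives a pregeometry on a monster model $\mathbb M$ of $T$. For a pregeometry, $S'\subseteq\mathbb M$ is independent over $B$ if $a\notin\operatorname{discl}((S'\setminus\{a\})\cup B)$ for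 all $a\in S'$; $\operatorname{rk}(S'/B)$ is the common cardinality of subsets $S_0\subseteq S'$ that are independent over $B$ with $S'\subseteq\operatorname{discl}(S_0\cup B)$. For definable $X$, $\operatorname{rk}_T^{\operatorname{discl}}(X/A)=\max\{\operatorname{rk}(\{a_1,\ldots,a_n\}/A):(a_1,\ldots,a_n)\in X^{\mathbb M}\}$, where $X^{\mathbb M}$ is the set defined in $\mathbb M$ by the same formula. Dimension: for nonempty definable $X\subseteq M^n$, $\dim X$ is the largest $d$ such that $\pi(X)$ has nonempty interior for some coordinate projection $\pi:M^n\to M^d$; $\dim\emptyset=-\infty$. *)

(* Defs.v *)
From mathcomp Require Import all_boot.
From mathcomp Require Import boolp classical_sets functions cardinality.

Set Implicit Arguments.
Unset Strict Implicit.
Unset Printing Implicit Defensive.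

Local Open Scope classical_set_scope.
Local Open Scope card_scope.

Record language := Language {
  fun_symb : nat -> Type;
  rel_symb : nat -> Type;
  less_symb : rel_symb 2 }.

(** [V] is the type of free variables; quantifiers bind the [None] of
    [option V]. Formulas with parameters in a set [A] are obtained by taking
    the elements of [A] as additional variables. *)
Inductive term (L : language) (V : Type) : Type :=
| tvar of V
| tapp (k : nat) of fun_symb L k & ('I_k -> term L V).

Inductive formula (L : language) (V : Type) : Type :=
| fbot
| feq of term L V & term L V
| fatom (k : nat) of rel_symb L k & ('I_k -> term L V)
| fimp of formula L V & formula L V
| fall of formula L (option V).

Arguments fbot {L V}.

Definition fneg (L : language) (V : Type) (phi : formula L V) : formula L V :=
  fimp phi fbot.

Definition sentence (L : language) := formula L void.

Record structure (L : language) := Structure {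
  carrier :> Type;
  carrier_inhabited : inhabited carrier;
  fun_interp : forall k, fun_symb L k -> ('I_k -> carrier) -> carrier;
  rel_interp : forall k, rel_symb L k -> ('I_k -> carrier) -> Prop }.

Section Semantics.
Variables (L : language) (M : structure L).

Fixpoint eval (V : Type) (v : V -> M) (t : term L V) : M :=
  match t with
  | tvar i => v i
  | tapp k f ts => fun_interp f (fun i => eval v (ts i))
  end.

Fixpoint sat (V : Type) (v : V -> M) (phi : formula L V) {struct phi} : Prop :=
  match phi with
  | fbot => False
  | feq t u => eval v t = eval v u
  | fatom k r ts => rel_interp r (fun i => eval v (ts i))
  | fimp phi1 phi2 => sat v phi1 -> sat v phi2
  | fall psi =>
      forall x : M, sat (fun o => if o is Some i then v i else x) psi
  end.

Definition holds (phi : sentence L) : Prop := sat (@of_void M) phi.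

Definition is_model (T : set (sentence L)) : Prop :=
  forall phi, T phi -> holds phi.

End Semantics.

Definition entails (L : language) (T : set (sentence L)) (phi : sentence L) :=
  forall N : structure L, is_model N T -> holds N phi.

Definition complete_theory (L : language) (T : set (sentence L)) : Prop :=
  (exists N : structure L, is_model N T) /\
  (forall phi, entails T phi \/ entails T (fneg phi)).

Definition formula_over (L : language) (M : structure L) (A : set M) (V : Type) :=
  formula L (V + {x : M | A x}).

Definition assign (L : language) (M N : structure L) (A : set M) (j : M -> N)
    (V : Type) (x : V -> N) (s : V + {c : M | A c}) : N :=
  match s with inl i => x i | inr c => j (proj1_sig c) end.

(** The parameters lie in a subset [A] of [M] and are interpreted in [N]
    through [j]; for sets defined in [M] itself, take [j := id]. *)
Definition defined_in (L : language) (M N : structure L) (A : set M)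
    (j : M -> N) (n : nat) (phi : formula_over A 'I_n) : set ('I_n -> N) :=
  [set x | sat (assign j x) phi].

Definition definable (L : language) (M : structure L) (n : nat)
    (X : set ('I_n -> M)) : Prop :=
  exists phi : formula_over [set: M] 'I_n, X = defined_in id phi.

Definition definable1 (L : language) (M : structure L) (X : set M) : Prop :=
  definable [set x : 'I_1 -> M | X (x ord0)].

Definition pair_fun (U : Type) (x y : U) (i : 'I_2) : U :=
  if i == ord0 then x else y.

Definition definable2 (L : language) (M : structure L) (Y : M -> set M) : Prop :=
  definable [set x : 'I_2 -> M | Y (x ord0) (x ord_max)].

Section Order.
Variables (U : Type) (lt : U -> U -> Prop).

(** [None] stands for an infinite endpoint. *)
Definition interval (a b : option U) : set U :=
  [set x | (if a is Some a' then lt a' x else True) /\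
           (if b is Some b' then lt x b' else True)].

Definition order_open (O : set U) : Prop :=
  forall x, O x -> exists a b, interval a b x /\ interval a b `<=` O.

Definition order_closed (F : set U) : Prop := order_open (~` F).

Definition order_discrete (D : set U) : Prop :=
  forall x, D x -> exists O, order_open O /\ O `&` D = [set x].

Definition prod_open (n : nat) (O : set ('I_n -> U)) : Prop :=
  forall x, O x -> exists a b : 'I_n -> option U,
    (forall i, interval (a i) (b i) (x i)) /\
    [set y | forall i, interval (a i) (b i) (y i)] `<=` O.

Definition prod_interior (n : nat) (X : set ('I_n -> U)) : set ('I_n -> U) :=
  [set x | exists O, [/\ prod_open O, O x & O `<=` X]].

Definition convex (C : set U) : Prop :=
  forall x y z, C x -> C y -> lt x z -> lt z y -> C z.

Definition dense_linear_order : Prop :=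
  [/\ forall x, ~ lt x x,
      forall x y z, lt x y -> lt y z -> lt x z,
      forall x y, lt x y \/ x = y \/ lt y x &
      forall x y, lt x y -> exists z, lt x z /\ lt z y].

Definition no_endpoints : Prop :=
  forall x, (exists y, lt y x) /\ (exists y, lt x y).

End Order.

Definition less (L : language) (M : structure L) (x y : M) : Prop :=
  rel_interp (less_symb L) (pair_fun x y).

Definition expands_dlo (L : language) (M : structure L) : Prop :=
  dense_linear_order (@less L M) /\ no_endpoints (@less L M).

Section Completion.
Variables (L : language) (M : structure L).

Record definable_gap := DefinableGap {
  gap_lo : set M;
  gap_hi : set M;
  gap_lo_definable : definable1 gap_lo;
  gap_hi_definable : definable1 gap_hi;
  gap_lo_nonempty : gap_lo !=set0;
  gap_hi_nonempty : gap_hi !=set0;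
  gap_cover : gap_lo `|` gap_hi = [set: M];
  gap_lt : forall a b, gap_lo a -> gap_hi b -> less a b;
  gap_lo_nomax : forall a, gap_lo a -> exists a', gap_lo a' /\ less a a';
  gap_hi_nomin : forall b, gap_hi b -> exists b', gap_hi b' /\ less b' b }.

Inductive completion : Type :=
| pt of M
| gap of definable_gap.

Definition cless (s t : completion) : Prop :=
  match s, t with
  | pt x, pt y => less x y
  | pt x, gap g => gap_lo g x
  | gap g, pt y => gap_hi g y
  | gap g, gap h => gap_lo g `<` gap_lo h
  end.

Definition cle (s t : completion) : Prop := s = t \/ cless s t.

Definition is_csup (Y : set M) (s : completion) : Prop :=
  (forall y, Y y -> cle (pt y) s) /\
  (forall t, (forall y, Y y -> cle (pt y) t) -> cle s t).

Definition interval_bar (a b : option M) : set completion :=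
  interval cless (omap pt a) (omap pt b).

Definition star_locally_weakly_o_minimal : Prop :=
  forall (X : set M) (s : completion), definable1 X ->
    exists a b : option M, interval_bar a b s /\
    exists (F : set M) (k : nat) (C : 'I_k -> set M),
      [/\ finite_set F,
          forall i, order_open (@less L M) (C i) /\ convex (@less L M) (C i) &
          X `&` interval (@less L M) a b = F `|` \bigcup_i C i].

(** Functions on a subset [D] of [M] are represented by functions on [M] of
    which only the values on [D] matter. *)
Definition definable_to_completion (D : set M) (f : M -> completion) : Prop :=
  exists Y : M -> set M, definable2 Y /\ forall x, D x -> is_csup (Y x) (f x).

Definition continuous_to_completion (J : set M) (f : M -> completion) : Prop :=
  forall O, order_open cless O ->
    exists2 P, order_open (@less L M) P & J `&` f @^-1` O = J `&` P.

Definition univariate_star_continuity : Prop :=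
  forall (a b : option M) (f : M -> completion),
    interval (@less L M) a b !=set0 ->
    definable_to_completion (interval (@less L M) a b) f ->
    exists c d : option M,
      [/\ interval (@less L M) c d !=set0,
          interval (@less L M) c d `<=` interval (@less L M) a b &
          continuous_to_completion (interval (@less L M) c d) f].

End Completion.

Section Dimension.
Variables (L : language) (M : structure L) (n : nat).

Definition proj_interior_nonempty (X : set ('I_n -> M)) (d : nat) : Prop :=
  exists2 s : 'I_d -> 'I_n, {homo s : i k / (i < k)%N} &
    prod_interior (@less L M) [set x \o s | x in X] !=set0.

(** [None] is the dimension minus infinity. *)
Definition is_dim (X : set ('I_n -> M)) (d : option nat) : Prop :=
  match d with
  | None => X = set0
  | Some k => [/\ X !=set0, proj_interior_nonempty X k &
                 forall m, proj_interior_nonempty X m -> (m <= k)%N]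
  end.

End Dimension.

Section Pregeometry.
Variables (U : Type) (cl : set U -> set U).

Definition independent_over (B S : set U) : Prop :=
  forall a, S a -> ~ cl ((S `\ a) `|` B) a.

Definition is_basis_over (B S S0 : set U) : Prop :=
  [/\ S0 `<=` S, independent_over B S0 & S `<=` cl (S0 `|` B)].

(** Only finite ranks are needed. All bases must have cardinality [k], so
    that no exchange property is presupposed. *)
Definition is_rk (B S : set U) (k : nat) : Prop :=
  (exists S0, is_basis_over B S S0) /\
  (forall S0, is_basis_over B S S0 -> S0 #= `I_k).

End Pregeometry.

Definition discl (L : language) (N : structure L) (B : set N) : set N :=
  [set x | exists phi : formula_over B 'I_1,
    let D := [set y : N | defined_in id phi (fun=> y)] in
    [/\ order_discrete (@less L N) D, order_closed (@less L N) D & D x]].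

Section Monster.
Variables (L : language) (K : Type).

(** The cardinal of [S] is smaller than that of [K]. *)
Definition small (U : Type) (S : set U) : Prop := ~ ([set: K] #<= S).

Definition saturated (N : structure L) : Prop :=
  forall (B : set N) (p : set (formula_over B 'I_1)), small B ->
    (forall q, finite_set q -> q `<=` p ->
       exists x, forall phi, q phi -> defined_in id phi x) ->
    exists x, forall phi, p phi -> defined_in id phi x.

Definition automorphism (N : structure L) (g : N -> N) : Prop :=
  [/\ bijective g,
      forall k (f : fun_symb L k) (x : 'I_k -> N),
        g (fun_interp f x) = fun_interp f (g \o x) &
      forall k (r : rel_symb L k) (x : 'I_k -> N),
        rel_interp r x <-> rel_interp r (g \o x)].

Definition partial_elementary (N : structure L) (B : set N) (h : N -> N) :=
  forall (k : nat) (phi : formula L 'I_k) (x : 'I_k -> N),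
    (forall i, B (x i)) -> (sat x phi <-> sat (h \o x) phi).

Definition strongly_homogeneous (N : structure L) : Prop :=
  forall (B : set N) (h : N -> N), small B -> partial_elementary B h ->
    exists2 g, automorphism g & forall x, B x -> g x = h x.

(** Saturation and homogeneity are with respect to the cardinal of [K], which
    exceeds the number of symbols of [L] and is uncountable. *)
Definition monster (N : structure L) : Prop :=
  [/\ small [set: nat],
      small [set: {k : nat & fun_symb L k}],
      small [set: {k : nat & rel_symb L k}],
      saturated N & strongly_homogeneous N].

End Monster.

Definition elementary_embedding (L : language) (M N : structure L)
    (j : M -> N) : Prop :=
  forall (k : nat) (phi : formula L 'I_k) (x : 'I_k -> M),
    sat x phi <-> sat (j \o x) phi.

(** [N] plays the role of the monster model, into which [M] is embedded by
    [j]. [None] is minus infinity, the maximum of the empty set. *)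
Definition is_discl_rank (L : language) (M N : structure L) (j : M -> N)
    (A : set M) (n : nat) (phi : formula_over A 'I_n) (d : option nat) : Prop :=
  let XN := defined_in j phi in
  let rk_is a := is_rk (@discl L N) (j @` A) (range a) in
  match d with
  | None => XN = set0
  | Some k => (exists2 a : 'I_n -> N, XN a & rk_is a k) /\
              (forall a : 'I_n -> N, XN a -> exists2 m, rk_is a m & (m <= k)%N)
  end.

Lemma is_dim_unique (L : language) (M : structure L) (n : nat)
    (X : set ('I_n -> M)) (d e : option nat) :
  is_dim X d -> is_dim X e -> d = e.
Proof.
case: d e => [k|] [l|] //=.
- by move=> [_ Pk mk] [_ Pl ml]; congr Some; apply/eqP; rewrite eqn_leq ml// mk.
- by move=> [[x Xx] _ _] X0; rewrite X0 in Xx.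
- by move=> X0 [[x Xx] _ _]; rewrite X0 in Xx.
Qed.

Lemma is_rk_unique (U : Type) (cl : set U -> set U) (B S : set U) (k l : nat) :
  is_rk cl B S k -> is_rk cl B S l -> k = l.
Proof.
move=> [[S0 S0b] hk] [_ hl]; apply/card_eq_II.
by rewrite -(card_eqr (hl _ S0b)) card_eq_sym hk.
Qed.

Lemma is_discl_rank_unique (L : language) (M N : structure L) (j : M -> N)
    (A : set M) (n : nat) (phi : formula_over A 'I_n) (d e : option nat) :
  is_discl_rank j phi d -> is_discl_rank j phi e -> d = e.
Proof.
case: d e => [k|] [l|] //=.
- move=> [[a Xa ak] mk] [[b Xb bl] ml]; congr Some; apply/eqP; rewrite eqn_leq.
  have [m am ml'] := ml _ Xa; have [m' bm mk'] := mk _ Xb.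
  by rewrite -(is_rk_unique ak am) in ml'; rewrite -(is_rk_unique bl bm) in mk'; rewrite ml' mk'.
- by move=> [[a Xa _] _] X0; rewrite X0 in Xa.
- by move=> X0 [[a Xa _] _]; rewrite X0 in Xa.
Qed.

(* Main.v *)
(** By local weak o-minimality, a definable subset of the line is discrete and
    closed exactly when it has empty interior ("thin"); so [discl B] is the union
    of the thin [B]-definable sets. Two facts about thin sets make [discl] a
    pregeometry. A union of thin fibres over a thin set is thin (transitivity):
    a choice of base point is definable, hence continuous on some interval, hence
    locally constant. If all fibres of [Y] in one direction are thin, so are all
    fibres in the other direction outside a thin set (exchange): the end points
    of a component of the latter move continuously.

    In the monster model, a small-definable set that contains an independent
    tuple [(z0, z')] contains a box: by saturation one finds [p < z0 < q] with
    [(p, q)] in the fibre over [z'] and [z'] still independent over [p, q], and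
    induction applies to the set of all [x'] whose fibre contains [(p, q)].
    Conversely saturation puts an independent tuple in every box. Containing a
    box is first-order, so it transfers between the model and the monster. *)
Require Import Defs.
From mathcomp Require Import all_boot.
From mathcomp Require Import boolp classical_sets functions cardinality.

Set Implicit Arguments.
Unset Strict Implicit.
Unset Printing Implicit Defensive.

Local Open Scope classical_set_scope.
Local Open Scope card_scope.

(** * Renaming and finite support *)

Section Renaming.
Variable L : language.

Fixpoint tren (V W : Type) (r : V -> W) (t : term L V) : term L W :=
  match t with
  | tvar i => tvar L (r i)
  | tapp k f ts => tapp f (fun i => tren r (ts i))
  end.

Fixpoint fren (V W : Type) (r : V -> W) (phi : formula L V) {struct phi} :
    formula L W :=
  match phi with
  | fbot => fbot
  | feq t u => feq (tren r t) (tren r u)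
  | fatom k R ts => fatom R (fun i => tren r (ts i))
  | fimp phi1 phi2 => fimp (fren r phi1) (fren r phi2)
  | fall psi => fall (fren (omap r) psi)
  end.

Lemma eval_ren (N : structure L) (V W : Type) (r : V -> W) (v : W -> N) t :
  eval v (tren r t) = eval (v \o r) t.
Proof.
by elim: t => //= k f ts IH; congr fun_interp; apply: funext => i; exact: IH.
Qed.

Lemma sat_ext (N : structure L) (V : Type) (v w : V -> N) (phi : formula L V) :
  (forall i, v i = w i) -> sat v phi <-> sat w phi.
Proof. by move=> /funext ->. Qed.

Lemma sat_ren (N : structure L) (V W : Type) (r : V -> W) (v : W -> N) phi :
  sat v (fren r phi) = sat (v \o r) phi.
Proof.
elim: phi W r v => //= {V}.
- by move=> V t u W r v; rewrite !eval_ren.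
- move=> V k R ts W r v; congr rel_interp; apply: funext => i; exact: eval_ren.
- by move=> V p IHp q IHq W r v; rewrite IHp IHq.
- move=> V p IH W r v; apply: eq_forall => x; rewrite IH.
  by congr sat; apply: funext => -[].
Qed.

Lemma tren_comp (U V W : Type) (r : U -> V) (s : V -> W) t :
  tren s (tren r t) = tren (s \o r) t.
Proof. by elim: t => //= k f ts IH; congr tapp; apply: funext. Qed.

Lemma fren_comp (U V W : Type) (r : U -> V) (s : V -> W) phi :
  fren s (fren r phi) = fren (s \o r) phi.
Proof.
elim: phi V W r s => //= {U}.
- by move=> U t u V W r s; rewrite !tren_comp.
- by move=> U k R ts V W r s; congr fatom; apply: funext => i; exact: tren_comp.
- by move=> U p IHp q IHq V W r s; rewrite IHp IHq.
- by move=> U p IH V W r s; rewrite IH; congr (fall (fren _ _));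
    apply: funext => -[].
Qed.

Definition subset_incl (V : Type) (F G : set V) (FG : F `<=` G)
  (x : {i | F i}) : {i | G i} := exist _ (sval x) (FG _ (svalP x)).

Lemma tren_sval_sub (V : Type) (F G : set V) (t : term L {i | F i}) :
  F `<=` G -> exists t' : term L {i | G i}, tren sval t' = tren sval t.
Proof. by move=> FG; exists (tren (subset_incl FG) t); rewrite tren_comp. Qed.

Lemma fren_sval_sub (V : Type) (F G : set V) (phi : formula L {i | F i}) :
  F `<=` G -> exists phi' : formula L {i | G i}, fren sval phi' = fren sval phi.
Proof. by move=> FG; exists (fren (subset_incl FG) phi); rewrite fren_comp. Qed.

Definition term_supported (V : Type) (t : term L V) (F : set V) :=
  exists t' : term L {i | F i}, t = tren sval t'.

Lemma terms_finite_support (V : Type) (k : nat) (ts : 'I_k -> term L V) :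
  (forall i, exists2 F, finite_set F & term_supported (ts i) F) ->
  exists2 G, finite_set G &
    exists ts' : 'I_k -> term L {i | G i}, ts = (fun i => tren sval (ts' i)).
Proof.
move=> tsP; have /choice[F FP] : forall i, exists F : set V,
    finite_set F /\ term_supported (ts i) F.
  by move=> i; have [F ? ?] := tsP i; exists F.
exists (\bigcup_i F i); first by apply: bigcup_finite => // i _; have [] := FP i.
have tsG i : term_supported (ts i) (\bigcup_i F i).
  have [_ [t' ->]] := FP i.
  have [|t'' <-] := @tren_sval_sub _ _ (\bigcup_i F i) t'; last by exists t''.
  exact: (@bigcup_sup _ _ i).
by have [ts' ts'E] := choice tsG; exists ts'; apply: funext.
Qed.

Lemma term_finite_support (V : Type) (t : term L V) :
  exists2 F : set V, finite_set F & term_supported t F.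
Proof.
elim: t => [i|k f ts /terms_finite_support[G finG [ts' ->]]].
  by exists [set i]; [exact: finite_set1|exists (tvar L (exist [set i] i erefl))].
by exists G => //; exists (tapp f ts').
Qed.

Lemma finite_preimage_some (V : Type) (F : set (option V)) :
  finite_set F -> finite_set (Some @^-1` F).
Proof. by move=> finF; apply: finite_preimage => // x y _ _ []. Qed.

(** Finite support serves twice: a definable set uses finitely many parameters, and elementarity,
    stated for the variable types ['I_k], extends to all variable types. *)
Lemma formula_finite_support (V : Type) (phi : formula L V) :
  exists2 F : set V, finite_set F &
    exists phi' : formula L {i | F i}, phi = fren sval phi'.
Proof.
elim: phi => {V} [V|V t u|V k R ts|V p [F finF [p' ->]] q [G finG [q' ->]]
  |V p [F finF [p' ->]]].
- by exists set0 => //; exists fbot.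
- have [F finF [t' ->]] := term_finite_support t.
  have [G finG [u' ->]] := term_finite_support u.
  have [t'' <-] := tren_sval_sub t' (@subsetUl _ F G).
  have [u'' <-] := tren_sval_sub u' (@subsetUr _ F G).
  by exists (F `|` G); [rewrite finite_setU|exists (feq t'' u'')].
- have [G finG [ts' ->]] :=
    terms_finite_support (fun i => term_finite_support (ts i)).
  by exists G => //; exists (fatom R ts').
- have [p'' <-] := fren_sval_sub p' (@subsetUl _ F G).
  have [q'' <-] := fren_sval_sub q' (@subsetUr _ F G).
  by exists (F `|` G); [rewrite finite_setU|exists (fimp p'' q'')].
- exists (Some @^-1` F); first exact: finite_preimage_some.
  pose r (o : {o | F o}) : option {i | F (Some i)} :=
    match o with
    | exist (Some i) Fi => Some (exist _ i Fi)
    | exist None _ => None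
    end.
  exists (fall (fren r p')) => /=; rewrite fren_comp; congr (fall (fren _ _)).
  by apply: funext => -[[i|] Fi].
Qed.

End Renaming.

(** * Definability *)

(** Definability is uniform over a family of structures [N_ t] that interpret
    the parameters in [C] through [c_ t]; a single structure is a family
    indexed by [unit], and two-element families transfer first-order
    statements along elementary embeddings. *)
Section Definability.
Variables (L : language) (C I : Type) (N_ : I -> structure L).
Variable c_ : forall t, C -> N_ t.
Implicit Types V W : Type.

Definition passign V t (v : V -> N_ t) (s : V + C) : N_ t :=
  match s with inl i => v i | inr c => c_ t c end.

Definition dfn V (P : forall t, (V -> N_ t) -> Prop) : Prop :=
  exists phi : formula L (V + C), forall t v, P t v <-> sat (passign v) phi.

Definition dtm V (f : forall t, (V -> N_ t) -> N_ t) : Prop :=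
  exists s : V + C, forall t v, f t v = passign v s.

Lemma dtm_var V (i : V) : dtm (fun t v => v i).
Proof. by exists (inl i). Qed.

Lemma dfn_ext V (P Q : forall t, (V -> N_ t) -> Prop) :
  (forall t v, P t v <-> Q t v) -> dfn P -> dfn Q.
Proof. by move=> PQ [phi phiE]; exists phi => t v; rewrite -PQ. Qed.

Lemma dfn_app V W (P : forall t, (V -> N_ t) -> Prop)
    (f : V -> forall t, (W -> N_ t) -> N_ t) :
  dfn P -> (forall i, dtm (f i)) -> dfn (fun t w => P t (fun i => f i t w)).
Proof.
move=> [phi phiE] /choice[r rE].
pose r' (s : V + C) := match s with inl i => r i | inr c => inr c end.
exists (fren r' phi) => t w; rewrite phiE sat_ren.
by apply: sat_ext => -[i|c] //=; exact: rE.
Qed.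

Lemma dfn_false V : dfn (fun t (v : V -> N_ t) => False).
Proof. by exists fbot. Qed.

Lemma dfn_imp V (P Q : forall t, (V -> N_ t) -> Prop) :
  dfn P -> dfn Q -> dfn (fun t v => P t v -> Q t v).
Proof.
by move=> [p pE] [q qE]; exists (fimp p q) => t v /=; rewrite pE qE.
Qed.

Lemma dfn_not V (P : forall t, (V -> N_ t) -> Prop) :
  dfn P -> dfn (fun t v => ~ P t v).
Proof. by move=> dP; apply: dfn_imp dP (dfn_false V). Qed.

Lemma dfn_and V (P Q : forall t, (V -> N_ t) -> Prop) :
  dfn P -> dfn Q -> dfn (fun t v => P t v /\ Q t v).
Proof.
move=> dP dQ; apply: dfn_ext (dfn_not (dfn_imp dP (dfn_not dQ))) => t v.
by rewrite not_implyP notK.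
Qed.

Lemma dfn_and3 V (P Q R : forall t, (V -> N_ t) -> Prop) :
  dfn P -> dfn Q -> dfn R -> dfn (fun t v => [/\ P t v, Q t v & R t v]).
Proof.
move=> dP dQ dR; apply: dfn_ext (dfn_and dP (dfn_and dQ dR)) => t v.
by split=> [[? []]|[]].
Qed.

Lemma dfn_or V (P Q : forall t, (V -> N_ t) -> Prop) :
  dfn P -> dfn Q -> dfn (fun t v => P t v \/ Q t v).
Proof.
move=> dP dQ; apply: dfn_ext (dfn_imp (dfn_not dP) dQ) => t v.
by split=> [h|[]//]; have [|/h] := pselect (P t v); [left|right].
Qed.

Definition oext V (U : Type) (v : V -> U) (x : U) (o : option V) : U :=
  if o is Some i then v i else x.

Lemma dfn_all_oext V (P : forall t, (option V -> N_ t) -> Prop) :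
  dfn P -> dfn (fun t v => forall x, P t (oext v x)).
Proof.
move=> [phi phiE].
(* The quantifier binds the [None] of [option (V + C)], whereas the variable in question sits inside
   [option V + C]; [r] moves it outside. *)
pose r (s : option V + C) : option (V + C) :=
  match s with
  | inl (Some i) => Some (inl i)
  | inl None => None
  | inr c => Some (inr c)
  end.
exists (fall (fren r phi)) => t v /=.
suff E x : P t (oext v x) <->
    sat (fun o => if o is Some i then passign v i else x) (fren r phi).
  by split=> h x; apply/E; apply: h.
rewrite phiE sat_ren.
by apply: sat_ext => -[[i|]|c].
Qed.

(** Applying [oext v x] to [None] and [Some] computes, so this is [dfn_all_oext] up to conversion,
    in a form that lets goals be decomposed connective by connective. *)
Lemma dfn_all V (P : forall t, N_ t -> (V -> N_ t) -> Prop) :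
  dfn (fun t (w : option V -> N_ t) => P t (w None) (fun i => w (Some i))) ->
  dfn (fun t v => forall x, P t x v).
Proof. by move=> /dfn_all_oext. Qed.

Lemma dfn_ex V (P : forall t, N_ t -> (V -> N_ t) -> Prop) :
  dfn (fun t (w : option V -> N_ t) => P t (w None) (fun i => w (Some i))) ->
  dfn (fun t v => exists x, P t x v).
Proof.
move=> dP; apply: dfn_ext (dfn_not (dfn_all (P := fun t x v => ~ P t x v) _)).
  by move=> t v; rewrite forallNE notK.
exact: dfn_not.
Qed.

Lemma dfn_less V (f g : forall t, (V -> N_ t) -> N_ t) :
  dtm f -> dtm g -> dfn (fun t v => less (f t v) (g t v)).
Proof.
move=> [r rE] [s sE].
exists (fatom (less_symb L) (fun i : 'I_2 => tvar L (pair_fun r s i))) => t v.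
rewrite rE sE /= /less (_ : pair_fun _ _ =
  fun i => passign v (pair_fun r s i)) //.
by apply: funext => i; rewrite /pair_fun; case: ifP.
Qed.

Lemma dfn_eq V (f g : forall t, (V -> N_ t) -> N_ t) :
  dtm f -> dtm g -> dfn (fun t v => f t v = g t v).
Proof.
by move=> [r rE] [s sE]; exists (feq (tvar L r) (tvar L s)) => t v; rewrite rE sE.
Qed.

Lemma dfn_app1 V (X : forall t, N_ t -> Prop) f :
  dfn (fun t (x : 'I_1 -> N_ t) => X t (x ord0)) -> dtm f ->
  dfn (fun t (v : V -> N_ t) => X t (f t v)).
Proof. by move=> dX df; exact: (dfn_app (f := fun=> f) dX). Qed.

Lemma dfn_app2 V (R : forall t, N_ t -> N_ t -> Prop) f g :
  dfn (fun t (x : 'I_2 -> N_ t) => R t (x ord0) (x ord_max)) ->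
  dtm f -> dtm g -> dfn (fun t (v : V -> N_ t) => R t (f t v) (g t v)).
Proof.
move=> dR df dg.
apply: dfn_ext (dfn_app (f := fun i => if i == ord0 then f else g) dR _) => //.
by move=> i; case: ifP.
Qed.

Lemma dfn_all_ord V m (P : 'I_m -> forall t, (V -> N_ t) -> Prop) :
  (forall i, dfn (P i)) -> dfn (fun t v => forall i, P i t v).
Proof.
elim: m P => [|m IH] P dP.
  by apply: dfn_ext (dfn_not (dfn_false V)) => t v; split=> // _ [].
apply: dfn_ext (dfn_and (dP ord0) (IH (fun i => P (lift ord0 i)) _)) => // t v.
split=> [[P0 PS] i|h]; last by split=> *; apply: h.
by case: (unliftP ord0 i) => [k|] ->.
Qed.

Definition ocons m (U : Type) (x0 : U) (x : 'I_m -> U) (i : 'I_m.+1) : U :=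
  if unlift ord0 i is Some k then x k else x0.

(** Induction on [m] with [V] varying: the head of the tuple becomes the variable [None] of
    [option V], and the induction hypothesis quantifies the tail. *)
Lemma dfn_all_tuple V m (P : forall t, ('I_m -> N_ t) -> (V -> N_ t) -> Prop) :
  dfn (fun t (w : 'I_m + V -> N_ t) => P t (w \o inl) (w \o inr)) ->
  dfn (fun t v => forall x, P t x v).
Proof.
elim: m V P => [|m IH] V P dP.
  pose f (s : 'I_0 + V) t (v : V -> N_ t) : N_ t :=
    match s with inl i => False_rect _ (notF (ltn_ord i)) | inr i => v i end.
  apply: dfn_ext (dfn_app (f := f) dP _) => [t v|[[]//|i]]; last exact: dtm_var.
  split=> [+ x|]; last exact.
  by congr (P t _ v); apply: funext => -[].
pose f (s : 'I_m.+1 + V) t (w : 'I_m + option V -> N_ t) : N_ t :=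
  match s with
  | inl i => ocons (w (inr None)) (w \o inl) i
  | inr i => w (inr (Some i))
  end.
have dQ : dfn (fun t v => forall x0 x, P t (ocons x0 x) v).
  apply/dfn_all/IH; apply: dfn_ext (dfn_app (f := f) dP _) => //= -[i|i].
    by case: (unliftP ord0 i) => [k|] ->; rewrite /f /ocons ?liftK ?unlift_none;
      exact: dtm_var.
  exact: dtm_var.
apply: dfn_ext dQ => t v; split=> h; last by move=> x0 x; exact: h.
move=> x; rewrite (_ : x = ocons (x ord0) (fun k => x (lift ord0 k))) //.
by apply: funext => i; rewrite /ocons; case: unliftP => [k|] ->.
Qed.

Lemma dfn_ex_tuple V m (P : forall t, ('I_m -> N_ t) -> (V -> N_ t) -> Prop) :
  dfn (fun t (w : 'I_m + V -> N_ t) => P t (w \o inl) (w \o inr)) ->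
  dfn (fun t v => exists x, P t x v).
Proof.
move=> dP.
apply: dfn_ext (dfn_not (dfn_all_tuple (P := fun t x v => ~ P t x v) _)).
  by move=> t v; rewrite forallNE notK.
exact: dfn_not.
Qed.

End Definability.

Notation dset B P :=
  (@dfn _ {x | B x} unit (fun=> _) (fun=> sval) _ (fun=> P)).
Notation def1 B X := (dset B (fun x : 'I_1 -> _ => X (x ord0))).
Notation def2 B R := (dset B (fun x : 'I_2 -> _ => R (x ord0) (x ord_max))).

(** * Definable sets in one structure *)

Section SingleStructure.
Variables (L : language) (N : structure L).
Implicit Types (B : set N) (V W : Type).

Lemma dset_definedP B n (X : set ('I_n -> N)) :
  dset B X <-> exists phi : formula_over B 'I_n, X = defined_in id phi.
Proof.
split=> [[phi phiE]|[phi ->]]; exists phi => //.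
by apply/funext => x; apply/propext; exact: (phiE tt).
Qed.

Lemma definable1P (X : set N) : definable1 X <-> def1 [set: N] X.
Proof. by rewrite dset_definedP. Qed.

Lemma definable2P (R : N -> set N) : definable2 R <-> def2 [set: N] R.
Proof. by rewrite dset_definedP. Qed.

Lemma dset_mono B B' V (P : set (V -> N)) : B `<=` B' -> dset B P -> dset B' P.
Proof.
move=> BB' [phi phiE].
pose r (s : V + {x | B x}) : V + {x | B' x} :=
  match s with inl i => inl i | inr c => inr (subset_incl BB' c) end.
exists (fren r phi) => t v; rewrite (phiE tt) sat_ren.
by apply: sat_ext => -[].
Qed.

Lemma dset_finite_params B V (P : set (V -> N)) : dset B P ->
  exists B0, [/\ finite_set B0, B0 `<=` B & dset B0 P].
Proof.
move=> [phi phiE]; have [F finF [psi psiE]] := formula_finite_support phi.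
pose B0 := [set x | exists Bx : B x, F (inr (exist _ x Bx))].
exists B0; split; last 1 first.
- pose r (s : {s | F s}) : V + {x | B0 x} :=
    match s with
    | exist (inl i) _ => inl i
    | exist (inr (exist x Bx)) Fx => inr (exist B0 x (ex_intro _ Bx Fx))
    end.
  exists (fren r psi) => t v; rewrite (phiE tt) psiE !sat_ren.
  by apply: sat_ext => -[[i|[x Bx]] Fs].
- pose g (s : V + {x | B x}) := if s is inr c then Some (sval c) else None.
  apply: (@sub_finite_set _ _ (Some @^-1` (g @` F))).
    by move=> x [Bx Fx]; exists (inr (exist _ x Bx)).
  by apply: finite_preimage_some; exact: finite_image.
- by move=> x [].
Qed.

Lemma dset_instance B b V (P : set (V -> N)) : dset (b |` B) P ->
  exists Q : set (option V -> N), dset B Q /\ forall v, P v <-> Q (oext v b).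
Proof.
move=> [phi phiE].
(* A parameter in [B] stays a parameter; any other one is [b] and becomes the new variable. *)
pose r (s : V + {x | (b |` B) x}) : option V + {x | B x} :=
  match s with
  | inl i => inl (Some i)
  | inr c => if pselect (B (sval c)) is left Bc then inr (exist _ _ Bc)
             else inl None
  end.
exists (fun w => sat (@passign _ _ _ (fun=> N) (fun=> sval) _ tt w) (fren r phi)).
split; first by exists (fren r phi) => -[].
move=> v; rewrite (phiE tt) sat_ren.
apply: sat_ext => -[i|[c Bc]] //=; case: pselect => //= nBc.
by case: Bc.
Qed.

End SingleStructure.

(** * Tame orders *)

Lemma dtm_const (L : language) (N : structure L) (B : set N) (V : Type) (b : N) :
  B b -> @dtm L {x | B x} unit (fun=> N) (fun=> sval) V (fun _ _ => b).
Proof. by move=> Bb; exists (inr (exist _ b Bb)). Qed.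

Ltac dtm_tac := first [exact: dtm_var | exact: dtm_const].

Ltac dfn_tac :=
  lazymatch goal with
  | |- dfn _ (fun t v => ~ _) => apply: dfn_not; dfn_tac
  | |- dfn _ (fun t v => _ /\ _) => apply: dfn_and; dfn_tac
  | |- dfn _ (fun t v => and3 _ _ _) => apply: dfn_and3; dfn_tac
  | |- dfn _ (fun t v => _ \/ _) => apply: dfn_or; dfn_tac
  | |- dfn _ (fun t v => exists x, _) => apply: dfn_ex; dfn_tac
  | |- dfn _ (fun t v => less _ _) => apply: dfn_less; dtm_tac
  | |- dfn _ (fun t v => _ = _) => apply: dfn_eq; dtm_tac
  | |- dfn _ (fun t v => forall x, _) =>
      first [apply: dfn_imp | apply: dfn_all]; dfn_tac
  | |- dfn _ (fun t v => ?R (@?f t v) (@?g t v)) =>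
      apply: (@dfn_app2 _ _ _ _ _ _ (fun=> R) f g); [done | dtm_tac | dtm_tac]
  | |- dfn _ (fun t v => ?R (@?f t v)) =>
      apply: (@dfn_app1 _ _ _ _ _ _ (fun=> R) f); [done | dtm_tac]
  end.

Lemma finite_set_induction (T : Type) (P : set T -> Prop) :
  P set0 -> (forall x F, P F -> P (x |` F)) -> forall F, finite_set F -> P F.
Proof.
move=> P0 PS F finF.
have [s ->] := (@finite_seqP {classic T} F).1 finF.
elim: s => [|x s IH]; first by rewrite set_nil.
rewrite (_ : [set` _] = x |` [set` s]); first exact: PS.
by apply/seteqP; split=> y /=; rewrite inE => /predU1P.
Qed.

Section OrderNotions.
Variables (U : Type) (lt : U -> U -> Prop).
Implicit Types S X : set U.

(** Empty interior as a first-order condition: in a definable family, thinness of the fibre is a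
    definable condition on the base point. *)
Definition thin X := forall a b, lt a b -> exists x, [/\ lt a x, lt x b & ~ X x].

(** A lower cut stands for its supremum in the completion. A maximum is allowed, so a point is
    represented both by the points below it and by the points up to it. *)
Definition cut S :=
  [/\ forall x y, S y -> lt x y -> S x, exists x, S x & exists x, ~ S x].

Definition near x (P : set U) :=
  exists p q, [/\ lt p x, lt x q & forall z, lt p z -> lt z q -> P z].

End OrderNotions.

Lemma near_flip (U : Type) (lt : U -> U -> Prop) x P :
  near lt x P -> near (fun u v => lt v u) x P.
Proof. by move=> [p [q [px xq pq]]]; exists q, p; split=> // z zq /pq; apply. Qed.

Lemma thin_flip (U : Type) (lt : U -> U -> Prop) X :
  thin lt X -> thin (fun u v => lt v u) X.
Proof. by move=> tX a b /tX[x [? ? ?]]; exists x. Qed.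

Lemma cut_flip (U : Type) (lt : U -> U -> Prop) S :
  (forall x y, lt x y \/ x = y \/ lt y x) ->
  cut (fun u v => lt v u) S -> cut lt (~` S).
Proof.
move=> tot [dS nS pS]; split; [|exact: pS|by case: nS => x Sx; exists x].
by move=> x y nSy xy Sx; apply: nSy; exact: dS Sx xy.
Qed.

Lemma thin_sub (U : Type) (lt : U -> U -> Prop) (X Y : set U) :
  X `<=` Y -> thin lt Y -> thin lt X.
Proof.
by move=> XY tY a b /tY[x [ax xb nYx]]; exists x; split=> // /XY.
Qed.

Section Tameness.
Variables (L : language) (N : structure L).
Implicit Types (lt : N -> N -> Prop) (S X : set N).

(** Local weak o-minimality and continuity expressed through lower cuts instead
    of points of the completion, which makes them invariant under reversal of
    the order. *)
Record tame lt : Prop := Tame {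
  tame_dlo : dense_linear_order lt;
  tame_no_endpoints : no_endpoints lt;
  tame_definable : def2 [set: N] lt;
  tame_local : forall S X, def1 [set: N] S -> cut lt S -> def1 [set: N] X ->
    exists a b, [/\ S a, ~ S b & exists CC : set (set N),
      [/\ finite_set CC, forall C, CC C -> convex lt C &
        forall y, lt a y -> lt y b -> (X y <-> exists2 C, CC C & C y)]];
  tame_continuous : forall (S : N -> set N) a b, def2 [set: N] S -> lt a b ->
    (forall x, lt a x -> lt x b -> cut lt (S x)) ->
    exists c d, [/\ lt c d,
      forall x, lt c x -> lt x d -> lt a x /\ lt x b &
      forall x, lt c x -> lt x d -> forall y z, lt y z ->
        (S x z -> near lt x (fun x' => S x' y)) /\
        (~ S x y -> near lt x (fun x' => ~ S x' z))] }.

Lemma def1C X : def1 [set: N] X -> def1 [set: N] (~` X).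
Proof. by move=> dX; exact: dfn_not dX. Qed.

(** Complements turn lower cuts of the reversed order into lower cuts of [lt] and exchange the two
    halves of continuity. One-sided results can thus be applied on the other side. *)
Lemma tame_flip lt : tame lt -> tame (fun u v => lt v u).
Proof.
move=> [[irr tr tot dns] ne dlt loc cont]; split.
- split=> //; first by move=> x y z yx zy; exact: tr zy yx.
    by move=> x y; have [|[]] := tot x y; auto.
  by move=> x y /dns[z [yz zx]]; exists z.
- by move=> x; have [] := ne x.
- by dfn_tac.
- move=> S X dS /(cut_flip tot) cS dX.
  have [a [b [nSa Sb [CC [fCC cCC CCE]]]]] := loc _ _ (def1C dS) cS dX.
  exists b, a; split=> //; first exact: contrapT.
  exists CC; split=> // [C /cCC cC x y z Cx Cy zx yz|y yb ay]; last exact: CCE.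
  exact: cC Cy Cx yz zx.
- move=> S a b dS ba cS.
  have [|x bx xa|d [c [dc dcb H]]] := cont (fun x => ~` S x) b a _ ba.
  + exact: dfn_not.
  + by apply: cut_flip => //; exact: cS.
  exists c, d; split=> // [x xc dx|x xc dx y z zy].
    by have [] := dcb x dx xc.
  have [H1 H2] := H x dx xc _ _ zy; split=> h; apply: near_flip.
    have [p [q [px xq pq]]] := H2 (fun nS => nS h).
    by exists p, q; split=> // u pu uq; apply: contrapT; exact: pq.
  by have [p [q [px xq pq]]] := H1 h; exists p, q.
Qed.

End Tameness.

(** * Thin sets *)

Section DenseOrders.
Variables (U : Type) (lt : U -> U -> Prop).
Hypotheses (dlo : dense_linear_order lt) (ne : no_endpoints lt).

Lemma dlo_irrefl x : ~ lt x x. Proof. by case: dlo. Qed.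
Lemma dlo_trans x y z : lt x y -> lt y z -> lt x z.
Proof. by case: dlo => _ + _ _; apply. Qed.
Lemma dlo_total x y : lt x y \/ x = y \/ lt y x. Proof. by case: dlo. Qed.
Lemma dlo_dense x y : lt x y -> exists z, lt x z /\ lt z y.
Proof. by case: dlo => _ _ _; apply. Qed.
Lemma dlo_below x : exists y, lt y x. Proof. by case: (ne x). Qed.
Lemma dlo_above x : exists y, lt x y. Proof. by case: (ne x). Qed.
Lemma dlo_asym x y : lt x y -> ~ lt y x.
Proof. by move=> xy /(dlo_trans xy)/dlo_irrefl. Qed.
Lemma dlo_nlt_lt x y z : ~ lt y x -> lt y z -> lt x z.
Proof.
by move=> nyx yz; have [xy|[->//|/nyx//]] := dlo_total x y;
  exact: dlo_trans yz.
Qed.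
Lemma dlo_lt_nlt x y z : lt x y -> ~ lt z y -> lt x z.
Proof.
by move=> xy nzy; have [yz|[<-//|/nzy//]] := dlo_total y z;
  exact: dlo_trans yz.
Qed.

Lemma dlo_min_below a b c : lt a b -> lt a c ->
  exists d, [/\ lt a d, ~ lt b d & ~ lt c d].
Proof.
have irr := dlo_irrefl; have asym := dlo_asym.
move=> ab ac; have [bc|[<-|cb]] := dlo_total b c.
- by exists b; split=> //; exact: asym.
- by exists b.
- by exists c; split=> //; exact: asym.
Qed.

Lemma dlo_max_above a b c : lt b a -> lt c a ->
  exists d, [/\ lt d a, ~ lt d b & ~ lt d c].
Proof.
have irr := dlo_irrefl; have asym := dlo_asym.
move=> ba ca; have [bc|[<-|cb]] := dlo_total b c.
- by exists c; split=> //; exact: asym.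
- by exists b.
- by exists b; split=> //; exact: asym.
Qed.

Lemma near_and x (P Q : set U) : near lt x P -> near lt x Q ->
  near lt x (fun y => P y /\ Q y).
Proof.
move=> [p [q [px xq pq]]] [p' [q' [px' xq' pq']]].
have [p0 [p0x pp0 pp0']] := dlo_max_above px px'.
have [q0 [xq0 qq0 qq0']] := dlo_min_below xq xq'.
exists p0, q0; split=> // z pz zq; split.
  by apply: pq; [exact: dlo_nlt_lt pz|exact: dlo_lt_nlt zq _].
by apply: pq'; [exact: dlo_nlt_lt pz|exact: dlo_lt_nlt zq _].
Qed.

Lemma near_mono x (P Q : set U) : P `<=` Q -> near lt x P -> near lt x Q.
Proof.
by move=> PQ [p [q [px xq pq]]]; exists p, q; split=> // z /pq/[apply]/PQ.
Qed.

Lemma near_self x (P : set U) : near lt x P -> P x.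
Proof. by move=> [p [q [px xq]]]; apply. Qed.

Lemma near_between a b x : lt a x -> lt x b ->
  near lt x (fun y => lt a y /\ lt y b).
Proof. by move=> ax xb; exists a, b. Qed.

Lemma near_not_thin x X : near lt x X -> ~ thin lt X.
Proof.
by move=> [p [q [px xq pq]]] /(_ _ _ (dlo_trans px xq))[z [pz zq]]; apply; exact: pq.
Qed.

Lemma not_thinP X :
  ~ thin lt X <-> exists a b, lt a b /\ forall x, lt a x -> lt x b -> X x.
Proof.
split=> [nX|[a [b [ab abX]]]].
  apply: contra_notP nX => nX a b ab; apply: contra_notP nX => nx.
  exists a, b; split=> // x ax xb; apply: contra_notP nx => nXx.
  by exists x.
by have [x [ax xb]] := dlo_dense ab; apply: (@near_not_thin x); exists a, b.
Qed.

Lemma near_interval a b x : interval lt a b x -> near lt x (interval lt a b).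
Proof.
move=> [ax xb].
have [p px pP] : exists2 p, lt p x & forall y, lt p y ->
    (if a is Some a' then lt a' y else True).
  case: a ax => [p|_]; first by exists p.
  by have [p px] := dlo_below x; exists p.
have [q xq qP] : exists2 q, lt x q & forall y, lt y q ->
    (if b is Some b' then lt y b' else True).
  case: b xb => [q|_]; first by exists q.
  by have [q xq] := dlo_above x; exists q.
by exists p, q; split=> // z pz zq; split; [exact: pP|exact: qP].
Qed.

End DenseOrders.

Section ThinSets.
Variables (L : language) (N : structure L) (lt : N -> N -> Prop).
Hypothesis T : tame lt.
Implicit Types (S X : set N).

Let lt_def : def2 [set: N] lt := tame_definable T.
Let irr := dlo_irrefl (tame_dlo T).
Let tr := dlo_trans (tame_dlo T).
Let tot := dlo_total (tame_dlo T).
Let above := dlo_above (tame_no_endpoints T).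
Let asym := dlo_asym (tame_dlo T).
Let nlt_lt := dlo_nlt_lt (tame_dlo T).
Let lt_nlt := dlo_lt_nlt (tame_dlo T).
Let min_below := dlo_min_below (tame_dlo T).

(** A convex piece with two points would contain the interval between them, so each of the finitely
    many pieces near the cut has at most one point. *)
Lemma thin_finite_at_cut S X : def1 [set: N] S -> cut lt S ->
  def1 [set: N] X -> thin lt X ->
  exists a b, [/\ S a, ~ S b & finite_set (X `&` [set x | lt a x /\ lt x b])].
Proof.
move=> dS cS dX tX.
have [a [b [Sa Sb [CC [fCC cCC CCE]]]]] := tame_local T dS cS dX.
exists a, b; split=> //; pose I := [set x | lt a x /\ lt x b].
apply: (@sub_finite_set _ _ (\bigcup_(C in CC) (C `&` I))).
  by move=> x [Xx [ax xb]]; have [C CCC Cx] := (CCE x ax xb).1 Xx; exists C.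
apply: bigcup_finite => // C CCC.
have half u v : (C `&` I) u -> (C `&` I) v -> ~ lt u v.
  move=> [Cu [au ub]] [Cv [av vb]] /[dup] uv /tX[z [uz zv]]; apply.
  apply/CCE; [exact: tr uz|exact: tr vb|exists C => //].
  exact: (cCC C CCC u v).
have [[u Iu]|nI] := pselect ((C `&` I) !=set0); last first.
  apply: (@sub_finite_set _ _ set0) => // u Iu; case: nI; by exists u.
apply: (@sub_finite_set _ _ [set u]); last exact: finite_set1.
move=> v Iv; have [uv|[//|vu]] := tot u v; first by case: (half u v).
by case: (half v u).
Qed.

Lemma finite_set_min (F : set N) : finite_set F -> F !=set0 ->
  exists2 m, F m & forall z, F z -> ~ lt z m.
Proof.
move: F; apply: finite_set_induction => [[]//|x F IH _].
have [/IH[m Fm mP]|nF] := pselect (F !=set0); last first.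
  by exists x; [left|move=> z [->//|Fz]; case: nF; exists z].
have [mx|[xm|xm]] := tot m x.
- by exists m; [right|move=> z [->|/mP//]; exact: asym].
- by exists m; [right|move=> z [->|/mP//]; rewrite xm; exact: irr].
- exists x; first by left.
  by move=> z [->//|Fz] /tr/(_ xm); exact: mP.
Qed.

Lemma finite_set_gap_above (F : set N) x : finite_set F ->
  exists2 q, lt x q & forall z, F z -> lt x z -> ~ lt z q.
Proof.
move: F; apply: finite_set_induction => [|y F [q xq qP]].
  by have [q xq] := above x; exists q.
have [xy|nxy] := pselect (lt x y); last first.
  by exists q => // z [->|/qP//]; move/nxy.
have [r [xr qr yr]] := min_below xq xy.
exists r => // z [->//|Fz] xz zr; apply: qP Fz xz _.
exact: lt_nlt zr qr.
Qed.

(** The cut of the points up to [x] has supremum [x], so [X] is finite on an interval directly above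
    [x], and finitely many points leave a gap there. *)
Lemma thin_gap_above X x : def1 [set: N] X -> thin lt X ->
  exists2 q, lt x q & forall z, lt x z -> lt z q -> ~ X z.
Proof.
move=> dX tX; pose S y := ~ lt x y.
have dS : def1 [set: N] S by rewrite /S; dfn_tac.
have cS : cut lt S.
  split; first by move=> u v nxv uv xu; apply: nxv; exact: tr uv.
    by exists x; exact: irr.
  by have [y xy] := above x; exists y; apply.
have [a [b [Sa /contrapT xb finI]]] := thin_finite_at_cut dS cS dX tX.
have [q xq qP] := finite_set_gap_above x finI.
have [r [xr br qr]] := min_below xb xq.
exists r => // z xz zr Xz; apply: (qP z) => //.
  split=> //; split; [exact: nlt_lt Sa xz|exact: lt_nlt br].
exact: lt_nlt qr.
Qed.

(** An interval has an initial part free of [X], in which the thinness of [Y] provides a point. *)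
Lemma thin_union X Y : def1 [set: N] X -> thin lt X -> thin lt Y ->
  thin lt (X `|` Y).
Proof.
move=> dX tX tY a b ab; have [q aq qP] := thin_gap_above a dX tX.
have [r [ar br qr]] := min_below ab aq.
have [z [az zr nYz]] := tY _ _ ar.
exists z; split=> //; first exact: lt_nlt br.
by move=> [|//]; apply: qP => //; exact: lt_nlt qr.
Qed.

(** The infimum of [Y] may be a gap a priori, but [X] is finite near the cut of the strict lower
    bounds of [Y], so only finitely many elements of [Y] compete for the minimum. *)
Lemma thin_subset_min X Y e : def1 [set: N] X -> thin lt X ->
  def1 [set: N] Y -> Y `<=` X -> Y !=set0 -> (forall y, Y y -> ~ lt y e) ->
  exists2 m, Y m & forall y, Y y -> ~ lt y m.
Proof.
move=> dX tX dY YX [y0 Yy0] Ye.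
have [Yee|nYe] := pselect (Y e); first by exists e.
pose S u := forall y, Y y -> lt u y.
have dS : def1 [set: N] S by rewrite /S; dfn_tac.
have cS : cut lt S.
  split; first by move=> u v Sv uv y /Sv; exact: tr.
    exists e => y Yy; have [//|[ey|/Ye//]] := tot e y.
    by move: Yy nYe; rewrite ey.
  by exists y0 => /(_ _ Yy0)/irr.
have [a [b [Sa nSb finI]]] := thin_finite_at_cut dS cS dX tX.
have [y1 Yy1 nby1] : exists2 y, Y y & ~ lt b y.
  by apply: contra_notP nSb => nY y Yy; apply: contra_notP nY => nby; exists y.
have finF : finite_set (Y `&` [set y | ~ lt b y]).
  apply: (@sub_finite_set _ _ (X `&` [set x | lt a x /\ lt x b] `|` [set b])).
    2: by rewrite finite_setU; split=> //; exact: finite_set1.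
  move=> y [Yy /= nby]; have [yb|[->|//]] := tot y b; last by right.
  by left; split; [exact: YX|split=> //; exact: Sa].
have [|m [Ym nbm] mP] := finite_set_min finF; first by exists y1.
exists m => // y Yy; have [by_|nby] := pselect (lt b y); last exact: mP.
by move=> ym; apply: nbm; exact: tr ym.
Qed.

End ThinSets.

Lemma thin_gap_below (L : language) (N : structure L) (lt : N -> N -> Prop)
    (X : set N) x :
  tame lt -> def1 [set: N] X -> thin lt X ->
  exists2 p, lt p x & forall z, lt p z -> lt z x -> ~ X z.
Proof.
move=> T dX tX.
have [p px pP] := thin_gap_above (tame_flip T) x dX (thin_flip tX).
by exists p => // z pz zx; exact: pP.
Qed.

Section OneSidedUnions.
Variables (L : language) (N : structure L) (lt : N -> N -> Prop).
Hypothesis T : tame lt.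
Implicit Types (S X : set N).

Let lt_def : def2 [set: N] lt := tame_definable T.
Let irr := dlo_irrefl (tame_dlo T).
Let tr := dlo_trans (tame_dlo T).
Let tot := dlo_total (tame_dlo T).
Let dns := dlo_dense (tame_dlo T).
Let below := dlo_below (tame_no_endpoints T).
Let above := dlo_above (tame_no_endpoints T).
Let nlt_lt := dlo_nlt_lt (tame_dlo T).
Let lt_nlt := dlo_lt_nlt (tame_dlo T).

(** The least [e] in [E] above [e0] whose fibre contains [x] depends
    continuously on [x]; as [E] is discrete, it is locally constant, so that a
    single fibre contains an interval. *)
Lemma thin_union_above (E : set N) (D : N -> set N) e0 :
  def1 [set: N] E -> thin lt E -> def2 [set: N] D ->
  (forall e, E e -> thin lt (D e)) ->
  thin lt [set x | exists e, [/\ E e, ~ lt e e0 & D e x]].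
Proof.
move=> dE tE dD tD; apply: contrapT => /(not_thinP (tame_dlo T))[a [b [ab abU]]].
(* [S x] is the cut of the points below the least base point whose fibre contains [x]. *)
pose S x y := forall e, E e -> ~ lt e e0 -> D e x -> lt y e.
have dS : def2 [set: N] S by rewrite /S; dfn_tac.
have minS x : lt a x -> lt x b -> exists m, [/\ E m, D m x,
    forall y, lt y m -> S x y & ~ S x m].
  move=> ax xb; pose Y e := [/\ E e, ~ lt e e0 & D e x].
  have dY : def1 [set: N] Y by rewrite /Y; dfn_tac.
  have YE : Y `<=` E by move=> e [].
  have [//|e []//|m [Em me0 Dm] mP] :=
    @thin_subset_min _ _ _ T E Y e0 dE tE dY YE; first exact: abU.
  exists m; split=> // [y ym e Ee ee0 De|/(_ _ Em me0 Dm)/irr//].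
  by apply: lt_nlt ym _; exact: mP.
have cS x : lt a x -> lt x b -> cut lt (S x).
  move=> ax xb; have [m [Em Dm Sm nSm]] := minS x ax xb.
  split; [by move=> y z Sz yz e Ee ee0 De; exact: tr (Sz _ Ee ee0 De)| |by exists m].
  by have [y /Sm] := below m; exists y.
have [c [d [cd cdab cont]]] := tame_continuous T dS ab cS.
have [x [cx xd]] := dns cd; have [ax xb] := cdab x cx xd.
have [m [Em Dm Sm nSm]] := minS x ax xb.
(* Isolate [m]: no other element of [E] lies between [p] and [q]. Continuity, with [u] and [r] as
   margins, keeps the least base point of every [y] near [x] between [p] and [q], so it equals
   [m]. *)
have [q mq qP] := thin_gap_above T m dE tE.
have [r [mr rq]] := dns mq.
have [p pm pP] := thin_gap_below m T dE tE.
have [u [pu um]] := dns pm.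
apply: (@near_not_thin _ _ (tame_dlo T) x (D m)); last exact: tD.
apply: near_mono (near_and (tame_dlo T) (near_between ax xb) (near_and (tame_dlo T)
  ((cont x cx xd p u pu).1 (Sm u um)) ((cont x cx xd m r mr).2 nSm))).
move=> y [[ay yb] [Sp nSr]]; have [m' [Em' Dm' Sm' nSm']] := minS y ay yb.
suff <- : m' = m by [].
have [m'm|[//|mm']] := tot m' m.
- case: (pP m') => //; apply: contrapT => npm'; apply: nSm' => e Ee ee0 De.
  by apply: nlt_lt npm' _; exact: Sp.
- case: (qP m') => //; apply: contrapT => nm'q; apply: nSr.
  by apply: Sm'; exact: lt_nlt rq nm'q.
Qed.

End OneSidedUnions.

(** * Thin fibres *)

Section OneSidedFibres.
Variables (L : language) (N : structure L) (lt : N -> N -> Prop).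
Hypothesis T : tame lt.
Implicit Types (S X : set N).

Let lt_def : def2 [set: N] lt := tame_definable T.
Let irr := dlo_irrefl (tame_dlo T).
Let tr := dlo_trans (tame_dlo T).
Let tot := dlo_total (tame_dlo T).
Let dns := dlo_dense (tame_dlo T).
Let above := dlo_above (tame_no_endpoints T).
Let asym := dlo_asym (tame_dlo T).
Let nlt_lt := dlo_nlt_lt (tame_dlo T).
Let lt_nlt := dlo_lt_nlt (tame_dlo T).
Let max_above := dlo_max_above (tame_dlo T).

Let cut_lt S x y : cut lt S -> S x -> ~ S y -> lt x y.
Proof.
move=> [dS _ _] Sx nSy; have [//|[xy|yx]] := tot x y; first by rewrite -xy in nSy.
by case: nSy; exact: dS Sx yx.
Qed.

(** Pigeonhole by induction on the family: a piece with no point between the cut and some [y0] is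
    discarded by looking only below [y0]. *)
Let accumulating_piece S (CC : set (set N)) : (exists y, ~ S y) -> finite_set CC ->
  (forall y, ~ S y -> exists C w, [/\ CC C, C w & ~ S w /\ lt w y]) ->
  exists2 C, CC C & forall y, ~ S y -> exists w, [/\ C w, ~ S w & lt w y].
Proof.
move=> [y1 nSy1]; move: CC; apply: finite_set_induction => [|C CC IH acc].
  by move=> /(_ _ nSy1)[C [w []]].
have [accC|naccC] :=
    pselect (forall y, ~ S y -> exists w, [/\ C w, ~ S w & lt w y]).
  by exists C; first left.
have [y0 nSy0 y0P] : exists2 y0, ~ S y0 & forall w, C w -> ~ S w -> ~ lt w y0.
  apply: contra_notP naccC => ny0 y nSy; apply: contra_notP ny0 => nw.
  by exists y => // w Cw nSw wy; apply: nw; exists w.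
have [|C' CCC' accC'] := IH; last by exists C'; first right.
move=> y nSy.
have [y' [nSy' yy' y0y']] : exists y', [/\ ~ S y', ~ lt y y' & ~ lt y0 y'].
  have [yy0|[<-|y0y]] := tot y y0.
  - by exists y; split=> //; exact: asym.
  - by exists y; split.
  - by exists y0; split=> //; exact: asym.
have [C' [w [CCC' C'w [nSw wy']]]] := acc _ nSy'.
case: CCC' => [CE|CCC'].
  by case: (y0P w) => //; [rewrite -CE|exact: lt_nlt y0y'].
by exists C', w; split=> //; split=> //; exact: lt_nlt yy'.
Qed.

(** One convex piece of [X] accumulates at the cut from above; by convexity it contains everything
    between the cut and any of its points. *)
Lemma germ_above_cut S X : def1 [set: N] S -> cut lt S -> def1 [set: N] X ->
  (forall y, ~ S y -> exists w, [/\ X w, ~ S w & lt w y]) ->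
  exists2 z, ~ S z & forall y, ~ S y -> lt y z -> X y.
Proof.
move=> dS cS dX accX.
have [a [b [Sa nSb [CC [fCC cCC CCE]]]]] := tame_local T dS cS dX.
have nS : exists y, ~ S y by exists b.
have [|C CCC accC] := accumulating_piece nS fCC.
  move=> y nSy.
  have [y' nSy' [yy' by']] : exists2 y', ~ S y' & ~ lt y y' /\ ~ lt b y'.
    have [yb|[<-|by_]] := tot y b.
    - by exists y => //; split; [exact: irr|exact: asym].
    - by exists y => //; split; exact: irr.
    - by exists b => //; split; [exact: asym|exact: irr].
  have [w [Xw nSw wy']] := accX _ nSy'.
  have wb := lt_nlt wy' by'; have wy := lt_nlt wy' yy'.
  have [C CCC Cw] := (CCE w (cut_lt cS Sa nSw) wb).1 Xw.
  by exists C, w.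
have [w0 [Cw0 nSw0 w0b]] := accC _ nSb.
exists w0 => // y nSy yw0; have [w1 [Cw1 nSw1 w1y]] := accC _ nSy.
apply/CCE; [exact: cut_lt Sa nSy|exact: tr w0b|exists C => //].
exact: cCC CCC _ _ _ Cw1 Cw0 w1y yw0.
Qed.

(** With [f x] the infimum of the part of [W x] above [b], and [g x] the
    supremum of the component of [W x] that starts at [f x], both [f] and [g]
    are continuous on some interval. A point strictly between [f x] and [g x]
    stays between them for nearby [x], so that its fibre contains an interval. *)
Lemma thin_domain_above (W : N -> set N) b : def2 [set: N] W ->
  (forall x w, W x w -> near lt w (W x)) ->
  (forall y, thin lt [set x | W x y]) ->
  thin lt [set x | exists w, W x w /\ lt b w].
Proof.
move=> dW Wop tW; apply: contrapT => /(not_thinP (tame_dlo T))[a0 [a1 [a01 aW]]].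
(* [S x] is the lower cut of [f x]. As [W x] is open, the infimum is not attained; this is [noMin]
   below. *)
pose S x y := forall w, W x w -> lt b w -> lt y w.
have dS : def2 [set: N] S by rewrite /S; dfn_tac.
have notS x w : W x w -> lt b w -> ~ S x w by move=> Ww bw /(_ _ Ww bw)/irr.
have Sdown x y z : S x z -> lt y z -> S x y.
  by move=> Sz yz w Ww bw; exact: tr yz (Sz _ Ww bw).
have noMin x y : ~ S x y -> exists w, [/\ W x w, lt b w & lt w y].
  move=> nSy; have [w [Ww bw nyw]] : exists w, [/\ W x w, lt b w & ~ lt y w].
    apply: contra_notP nSy => nw w Ww bw; apply: contra_notP nw => nyw.
    by exists w.
  have [p [q [pw wq pqW]]] := Wop _ _ Ww.
  have [d [dw pd bd]] := max_above pw bw.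
  have [w' [dw' w'w]] := dns dw; exists w'; split.
  - by apply: pqW; [exact: nlt_lt pd dw'|exact: tr wq].
  - exact: nlt_lt bd dw'.
  - exact: lt_nlt nyw.
have Sb x : S x b by [].
have cS x : lt a0 x -> lt x a1 -> cut lt (S x).
  move=> ax xa; split; [by move=> y z Sz; exact: Sdown|by exists b|].
  by have [w [Ww bw]] := aW x ax xa; exists w; exact: notS.
have [c [d [cd cda cont]]] := tame_continuous T dS a01 cS.
have [x0 [cx0 x0d]] := dns cd; have [ax0 x0a] := cda _ cx0 x0d.
have [w0 [Ww0 bw0]] := aW _ ax0 x0a.
(* [w1] is a margin: continuity carries [~ S x0 w1] over to [~ S x w0] for [x] near [x0]. *)
have [w1 [Ww1 bw1 w10]] := noMin _ _ (notS _ _ Ww0 bw0).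
have [p [q [px0 x0q pqP]]] := near_and (tame_dlo T) (near_between cx0 x0d)
  ((cont _ cx0 x0d _ _ w10).2 (notS _ _ Ww1 bw1)).
(* [G x] is the lower cut of [g x] capped at [w0]; the cap keeps it proper even if the component is
   unbounded. *)
pose G x z := S x z \/ (~ lt w0 z /\ forall y, ~ S x y -> lt y z -> W x y).
have dG : def2 [set: N] G by rewrite /G; dfn_tac.
have cG x : lt p x -> lt x q -> cut lt (G x).
  move=> px xq; have [_ nSw0] := pqP x px xq; split.
  - move=> y z [Sz|[nw0z Wz]] yz; first by left; exact: Sdown yz.
    right; split=> [w0y|u nSu uy]; first by apply: nw0z; exact: tr yz.
    by apply: Wz => //; exact: tr yz.
  - by exists b; left.
  - have [u w0u] := above w0; exists u => -[Su|[]//].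
    by apply: nSw0; exact: Sdown w0u.
have [c' [d' [cd' cd'pq cont']]] := tame_continuous T dG (tr px0 x0q) cG.
have [x1 [cx1 x1d]] := dns cd'; have [px1 x1q] := cd'pq _ cx1 x1d.
have [[cx1' x1d'] nSw0] := pqP _ px1 x1q.
have [ax1 x1a] := cda _ cx1' x1d'.
have [||||z0 nSz0 z0P] := @germ_above_cut (S x1) (W x1).
- by dfn_tac.
- exact: cS.
- by dfn_tac.
- move=> y /noMin[w [Ww bw wy]]; exists w; split=> //; exact: notS.
have [z [nSz nw0z nz0z]] : exists z, [/\ ~ S x1 z, ~ lt w0 z & ~ lt z0 z].
  have [zw|[<-|wz]] := tot z0 w0.
  - by exists z0; split=> //; exact: asym.
  - by exists z0; split.
  - by exists w0; split=> //; exact: asym.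
have Gz : G x1 z.
  by right; split=> // y nSy yz; apply: z0P => //; exact: lt_nlt nz0z.
(* Continuity of [S] keeps [u2] above the cut at the cost of the margin from [u1]; continuity of [G]
   keeps [u3] in [G] at the cost of the margin to [z]. Hence [u2] stays inside the component for all
   [x] near [x1]. *)
have [u3 [Wu3 bu3 u3z]] := noMin _ _ nSz.
have [u2 [Wu2 bu2 u23]] := noMin _ _ (notS _ _ Wu3 bu3).
have [u1 [Wu1 bu1 u12]] := noMin _ _ (notS _ _ Wu2 bu2).
apply: (@near_not_thin _ _ (tame_dlo T) x1 [set x | W x u2]); last exact: tW.
apply: near_mono (near_and (tame_dlo T)
  ((cont _ cx1' x1d' _ _ u12).2 (notS _ _ Wu1 bu1))
  ((cont' _ cx1 x1d _ _ u3z).1 Gz)).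
move=> x [nSu2 [Su3|[_ Wu]]]; first by case: nSu2; exact: Sdown u23.
exact: Wu.
Qed.

End OneSidedFibres.

Section TwoSided.
Variables (L : language) (N : structure L) (lt : N -> N -> Prop).
Hypothesis T : tame lt.

Let lt_def : def2 [set: N] lt := tame_definable T.

(** The base points on the two sides of an arbitrary [e0] are treated separately, the lower side
    through the reversed order. *)
Lemma thin_union_fibres (E : set N) (D : N -> set N) :
  def1 [set: N] E -> thin lt E -> def2 [set: N] D ->
  (forall e, E e -> thin lt (D e)) ->
  thin lt [set x | exists2 e, E e & D e x].
Proof.
move=> dE tE dD tD; have [e0] := carrier_inhabited N.
have tE' := thin_flip tE.
have tU := thin_union_above T e0 dE tE dD tD.
have tU' := thin_flip (thin_union_above (tame_flip T) e0 dE tE' dD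
  (fun e Ee => thin_flip (tD e Ee))).
apply: thin_sub (thin_union T _ tU tU'); last by rewrite /mkset; cbv beta; dfn_tac.
move=> x [e Ee De]; have [ne|le] := pselect (lt e e0); last by left; exists e.
by right; exists e; split=> //; exact: dlo_asym (tame_dlo T) _ _ ne.
Qed.

(** Passing to the interior [W x] of each fibre gives open fibres. A fibre with interior has an
    interior point above or below an arbitrary [b], which gives two one-sided cases. *)
Lemma thin_not_thin_fibres (Y : N -> set N) : def2 [set: N] Y ->
  (forall y, thin lt [set x | Y x y]) -> thin lt [set x | ~ thin lt (Y x)].
Proof.
move=> dY tY; pose W x y := exists p q, [/\ lt p y, lt y q &
  forall z, lt p z -> lt z q -> Y x z].
have dW : def2 [set: N] W by rewrite /W; dfn_tac.
have Wop x w : W x w -> near lt w (W x).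
  by move=> [p [q [pw wq pqY]]]; exists p, q; split=> // z pz zq; exists p, q.
have tW y : thin lt [set x | W x y].
  by apply: thin_sub (tY y) => x; exact: (near_self (P := Y x)).
have [b] := carrier_inhabited N.
have tU := thin_domain_above T b dW Wop tW.
have tU' := thin_flip (thin_domain_above (tame_flip T) b dW
  (fun x w Ww => near_flip (Wop x w Ww)) (fun y => thin_flip (tW y))).
apply: thin_sub (thin_union T _ tU tU'); last by rewrite /mkset; cbv beta; dfn_tac.
move=> x /(not_thinP (tame_dlo T))[p [q [pq pqY]]].
have pqW y : lt p y -> lt y q -> W x y by move=> py yq; exists p, q.
have [y [py yq]] := dlo_dense (tame_dlo T) pq.
have [yb|[<-|by_]] := dlo_total (tame_dlo T) y b; last 1 first.
- by left; exists y; split=> //; exact: pqW.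
- by right; exists y; split=> //; exact: pqW.
- have [z [yz zq]] := dlo_dense (tame_dlo T) yq; left; exists z; split=> //.
  by apply: pqW => //; exact: (dlo_trans (tame_dlo T) py yz).
Qed.

End TwoSided.

(** * Models are tame *)

Section TameModels.
Variables (L : language) (N : structure L).
Hypothesis dlo : expands_dlo N.
Implicit Types (S X : set N) (s : completion N) (x y z : N).

Let irr := dlo_irrefl dlo.1.
Let tr := dlo_trans dlo.1.
Let tot := dlo_total dlo.1.
Let dns := dlo_dense dlo.1.

Lemma cless_pt_cle y s : cless (pt y) s -> ~ cle s (pt y).
Proof.
case: s => [x|g] /= => [yx [[xy]|xy]|gy [//|hy]].
- by move: yx; rewrite xy; exact: irr.
- exact: irr (tr yx xy).
- exact: irr (gap_lt gy hy).
Qed.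

Lemma less_cle_cless y z s : less y z -> cle (pt z) s -> cless (pt y) s.
Proof.
case: s => [x|g] yz [] //= => [[<-]//|zx|gz]; first exact: tr zx.
have : (gap_lo g `|` gap_hi g) y by rewrite gap_cover.
by case=> // /(gap_lt gz) /(tr yz) /irr.
Qed.

Lemma cle_less_cless y z s : cle s (pt y) -> less y z -> cless s (pt z).
Proof.
case: s => [x|g] [] //= => [[->]//|xy yz|gy yz]; first exact: tr yz.
have : (gap_lo g `|` gap_hi g) z by rewrite gap_cover.
by case=> // /gap_lt /(_ gy) /(tr yz) /irr.
Qed.

(** The supremum is the maximum of the cut or the minimum of its complement; if neither exists, the
    cut and its complement form a definable gap. *)
Lemma cut_csup S : def1 [set: N] S -> cut (@less L N) S -> exists s, is_csup S s.
Proof.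
move=> dS [Sdown [x0 Sx0] [y0 nSy0]].
have Slt x y : S x -> ~ S y -> less x y.
  move=> Sx nSy; have [//|[xy|yx]] := tot x y; first by rewrite -xy in nSy.
  by case: nSy; exact: Sdown Sx yx.
have [[m [Sm mP]]|nmax] := pselect (exists m, S m /\ forall y, S y -> ~ less m y).
  exists (pt m); split=> [y Sy|t]; last exact.
  by have [ym|[->|/mP]] := tot y m; [right|left|].
have [[m [nSm mP]]|nmin] :=
    pselect (exists m, ~ S m /\ forall y, ~ S y -> ~ less y m).
  exists (pt m); split=> [y Sy|t tP]; first by right; exact: Slt.
  case: t tP => [x|g] tP.
    have [mx|[->|xm]] := tot m x; [by right|by left|].
    have Sx : S x by apply: contrapT => /mP.
    case: nmax; exists x; split=> // y Sy xy.
    by case: (tP y Sy) => [[yx]|/(tr xy)/irr//]; move: xy; rewrite yx; exact: irr.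
  right=> /=; have : (gap_lo g `|` gap_hi g) m by rewrite gap_cover.
  case=> // gm; have [z [gz zm]] := gap_hi_nomin gm.
  have Sz : S z by apply: contrapT => /mP.
  by case: (tP z Sz) => // lz; case: (irr (gap_lt lz gz)).
have nomax a : S a -> exists a', S a' /\ less a a'.
  move=> Sa; apply: contra_notP nmax => na; exists a; split=> // y Sy ay.
  by apply: na; exists y.
have nomin b : (~` S) b -> exists b', (~` S) b' /\ less b' b.
  move=> Sb; apply: contra_notP nmin => nb; exists b; split=> // y Sy yb.
  by apply: nb; exists y.
pose g := @DefinableGap L N S (~` S) ((definable1P S).2 dS)
  ((definable1P (~` S)).2 (def1C dS)) (ex_intro _ x0 Sx0) (ex_intro _ y0 nSy0)
  (setUv S) Slt nomax nomin.
exists (gap g); split=> [y Sy|[x|h] tP]; first by right.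
- right=> /= Sx; have [x' [Sx' xx']] := nomax _ Sx.
  by case: (tP x' Sx') => [[xE]|/(tr xx')/irr//]; move: xx'; rewrite xE; exact: irr.
- have Sh : S `<=` gap_lo h by move=> y /tP[].
  have [hS|nhS] := pselect (gap_lo h `<=` S); last by right; split.
  left; congr gap; have loE : S = gap_lo h by apply/seteqP.
  have hiE : ~` S = gap_hi h.
    apply/seteqP; split=> y; last by move=> hy /Sh /gap_lt/(_ hy)/irr.
    have : (gap_lo h `|` gap_hi h) y by rewrite gap_cover.
    by case=> // /hS.
  rewrite /g; move: h tP loE hiE {Sh hS} => [lo hi ? ? ? ? ? ? ? ?] _ /= loE hiE.
  by subst lo hi; congr DefinableGap; exact: Prop_irrelevance.
Qed.

Section Csup.
Variables (S : set N) (s : completion N).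
Hypotheses (cS : cut (@less L N) S) (sS : is_csup S s).

Lemma cless_csup a : cless (pt a) s -> S a.
Proof.
move=> as_; apply: contrapT => nSa; apply: cless_pt_cle as_ _.
apply: sS.2 => y Sy; right=> /=; case: cS => Sdown _ _.
have [//|[ya|ay]] := tot y a; first by rewrite -ya in nSa.
by case: nSa; exact: Sdown Sy ay.
Qed.

Lemma csup_cless b : cless s (pt b) -> ~ S b.
Proof.
move=> sb Sb; have [bs|bs] := sS.1 b Sb; last by apply: (cless_pt_cle bs); right.
by move: sb; rewrite -bs => /irr.
Qed.

End Csup.

Hypothesis swom : star_locally_weakly_o_minimal N.
Hypothesis scont : univariate_star_continuity N.

(** Each cut is replaced by its supremum in the completion, where the two hypotheses on the
    structure apply. *)
Lemma tame_less : tame (@less L N).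
Proof.
have [d ne] := dlo; split=> //.
- by dfn_tac.
- move=> S X dS cS dX; have [s sS] := cut_csup dS cS.
  have [a [b [[as_ sb] [F [k [C [finF CP XE]]]]]]] :=
    swom s ((definable1P X).2 dX).
  have [a' Sa' aa'] : exists2 a', S a' & forall y, less a' y ->
      (if a is Some a0 then less a0 y else True).
    case: a as_ {XE} => [a0 /= as_|_]; last by case: cS => _ [x Sx] _; exists x.
    by exists a0 => //; exact: cless_csup as_.
  have [b' nSb' bb'] : exists2 b', ~ S b' & forall y, less y b' ->
      (if b is Some b0 then less y b0 else True).
    case: b sb {XE} => [b0 /= sb|_]; last by case: cS => _ _ [x Sx]; exists x.
    by exists b0 => //; exact: csup_cless sb.
  exists a', b'; split=> //.
  (* Points of the finite part count as singleton convex sets. *)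
  exists (set1 @` F `|` range C); split.
  + by rewrite finite_setU; split; [exact: finite_image|exact: finite_image].
  + move=> _ [[x _ <-] u v z /= -> -> xz zx|[i _ <-]]; last by case: (CP i).
    by case: (irr (tr xz zx)).
  + move=> y ay yb; have Iy : interval (@less L N) a b y.
      by split; [exact: aa'|exact: bb'].
    have -> : X y <-> (X `&` interval (@less L N) a b) y by split=> [|[]].
    rewrite XE; split=> [[Fy|[i _ Cy]]|[_ [[x Fx <-] ->|[i _ <-] Cy]]].
    * by exists [set y] => //; left; exists y.
    * by exists (C i) => //; right; exists i.
    * by left.
    * by right; exists i.
- move=> S a b dS ab cS.
  have /choice[f fS] : forall x, exists s, less a x -> less x b -> is_csup (S x) s.
    move=> x; have [[ax xb]|nx] := pselect (less a x /\ less x b).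
      have [|s sS] := cut_csup _ (cS x ax xb); first by dfn_tac.
      by exists s.
    by exists (pt a) => ax xb; case: nx.
  have [||c [d' [[x0 [cx0 xd0]] sub cont]]] := @scont (Some a) (Some b) f.
  + by have [z] := dns ab; exists z.
  + exists S; split; first exact/definable2P.
    by move=> x [/= ax xb]; exact: fS.
  have [c1 [d1 [c1x xd1 inJ]]] := near_interval ne (conj cx0 xd0).
  exists c1, d1; split; first exact: tr xd1.
    by move=> x cx xd; have [] := sub x (inJ x cx xd).
  move=> x cx xd; have [ax xb] := sub x (inJ x cx xd).
  have near_of_open O : order_open (@cless L N) O -> O (f x) ->
      near (@less L N) x (fun y => interval (@less L N) c d' y /\ O (f y)).
    move=> oO Ofx; have [P oP PE] := cont O oO.
    have [_ Px] : (interval (@less L N) c d' `&` P) x.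
      by rewrite -PE; split=> //; exact: inJ.
    have [p [q [pxq pqP]]] := oP x Px.
    apply: near_mono (near_and d (near_interval ne (inJ x cx xd))
      (near_interval ne pxq)).
    move=> y [Jy /pqP Py]; split=> //.
    by have [] : (interval (@less L N) c d' `&` f @^-1` O) y by rewrite PE.
  (* The two halves come from the open rays above [y] and below [z] in the completion. A cut
     determines comparison with its supremum only up to equality; the slack between [y] and [z]
     makes it strict. *)
  move=> y z yz; split=> [Sz|nSy].
  + apply: near_mono (near_of_open [set t | cless (pt y) t] _ _).
    * move=> x' [/sub[ax' xb'] yf].
      by apply: (cless_csup (cS x' ax' xb') (fS x' ax' xb')); exact: yf.
    * by move=> t yt; exists (Some (pt y)), None; split=> // u [].
    * by apply: less_cle_cless yz _; exact: (fS x ax xb).1.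
  + apply: near_mono (near_of_open [set t | cless t (pt z)] _ _).
    * move=> x' [/sub[ax' xb'] fz].
      by apply: (csup_cless (fS x' ax' xb')); exact: fz.
    * by move=> t tz; exists None, (Some (pt z)); split=> // u [].
    * apply: cle_less_cless yz; apply: (fS x ax xb).2 => u Su; right=> /=.
      have [Sdown _ _] := cS x ax xb.
      have [//|[uy|yu]] := tot u y; first by rewrite uy in Su.
      by case: nSy; exact: Sdown Su yu.
Qed.

End TameModels.

(** * Finite pregeometries *)

Section Matroid.
Variables (U : eqType) (cl : set U -> set U).
Hypothesis cl_ext : forall B, B `<=` cl B.
Hypothesis cl_mono : forall B C, B `<=` C -> cl B `<=` cl C.
Hypothesis cl_idem : forall B, cl (cl B) `<=` cl B.
Hypothesis cl_exchange : forall B a b, cl (b |` B) a -> ~ cl B a -> cl (a |` B) b.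
Implicit Types (B S : set U) (s t g : seq U).

Definition adjoin B s : set U := [set` s] `|` B.

(** Independence with each entry tested only against the later ones, a form suited to induction. *)
Fixpoint ind B s : Prop :=
  if s is x :: t then ~ cl (adjoin B t) x /\ ind B t else True.

Lemma adjoin_nil B : adjoin B [::] = B.
Proof. by rewrite /adjoin set_nil set0U. Qed.

Lemma adjoin_cons B x t : adjoin B (x :: t) = x |` adjoin B t.
Proof.
rewrite /adjoin setUA; congr (_ `|` _).
by apply/seteqP; split=> y /=; rewrite inE => /predU1P.
Qed.

Lemma adjoin_setU1 B x t : adjoin (x |` B) t = x |` adjoin B t.
Proof. by rewrite /adjoin setUCA. Qed.

Lemma sub_adjoin B s t : {subset s <= t} -> adjoin B s `<=` adjoin B t.
Proof. by move=> st x [/st|]; [left|right]. Qed.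

Lemma cl_trans B C : B `<=` cl C -> cl B `<=` cl C.
Proof. by move=> BC x /(cl_mono BC); exact: cl_idem. Qed.

(** If [y] made [x] dependent on the later entries, exchange would put [y] into the closure of [x]
    and those entries. *)
Lemma ind_setU1 B s y : ind B s -> ~ cl (adjoin B s) y -> ind (y |` B) s.
Proof.
elim: s => //= x t IH [nx indt]; rewrite adjoin_cons => ny; split.
  by rewrite adjoin_setU1 => /cl_exchange/(_ nx).
by apply: IH => // yt; apply: ny; apply: cl_mono yt; exact: subsetUr.
Qed.

(** At most one entry is dropped, namely one whose later entries do not span [y] although it does
    together with them or was not tested further. Entries whose tail spans [y] survive, since [y]
    adds nothing to the closure of that tail. *)
Lemma ind_setU1_remove B s y : ind B s ->
  exists t, [/\ {subset t <= s}, (size s <= (size t).+1)%N & ind (y |` B) t].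
Proof.
elim: s => [|x s IH] /=; first by exists [::].
move=> [nx inds]; have [ys|nys] := pselect (cl (adjoin B s) y); last first.
  exists s; split=> //; last exact: ind_setU1.
  by move=> z; rewrite inE orbC => ->.
have [t [ts st indt]] := IH inds; exists (x :: t); split=> //=.
  by move=> z; rewrite !inE => /predU1P[->|/ts->]; rewrite ?eqxx// orbT.
split=> //; rewrite adjoin_setU1 => xt; apply: nx; apply: cl_trans xt.
by move=> z [->//|/(sub_adjoin ts)]; exact: cl_ext.
Qed.

(** The entries of [g] move into the base one at a time, each costing [s] at most one entry. *)
Lemma steinitz B s g : ind B s -> [set` s] `<=` cl (adjoin B g) ->
  (size s <= size g)%N.
Proof.
elim: g B s => [|y g IH] B s inds sg.
  case: s inds sg => //= x t [nx _] sg; case: nx.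
  have := sg x (mem_head x t); rewrite adjoin_nil; apply: cl_mono.
  exact: subsetUr.
have [t [ts st indt]] := ind_setU1_remove y inds.
apply: leq_trans st _; rewrite ltnS; apply: IH indt _.
by move=> x /ts xs; rewrite adjoin_setU1 -adjoin_cons; exact: sg.
Qed.

Lemma ind_of_independent B s : uniq s -> independent_over cl B [set` s] -> ind B s.
Proof.
elim: s => //= x t IH /andP[xt ut] indS; split.
  have xS : [set` x :: t] x by rewrite /= mem_head.
  apply: contra_not (indS x xS); apply: cl_mono => y [yt|]; last by right.
  left; split; first by rewrite /= inE yt orbT.
  by move=> yx; rewrite -yx yt in xt.
apply: IH => // y yt; have yS : [set` x :: t] y by rewrite /= inE yt orbT.
apply: contra_not (indS y yS); apply: cl_mono => z [[zt zy]|]; last by right.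
by left; split=> //; rewrite /= inE zt orbT.
Qed.

Lemma card_set_seq s : uniq s -> [set` s] #= `I_(size s).
Proof.
move=> us; apply/card_set_bijP; exists (index^~ s); split.
- by move=> x /= xs; rewrite index_mem.
- move=> x y /[!inE]/= xs ys xy.
  by rewrite -(nth_index x xs) -(nth_index x ys) xy.
- case: s us => // x s us i i_lt; exists (nth x (x :: s) i).
    exact: mem_nth.
  exact: index_uniq.
Qed.

Lemma basis_seq B S S0 s : S = [set` s] -> is_basis_over cl B S S0 ->
  exists t, [/\ uniq t, S0 = [set` t], ind B t, {subset t <= s} &
    S `<=` cl (adjoin B t)].
Proof.
move=> -> [S0s indS0 spanS0].
have /finite_seqP[u S0E] : finite_set S0 by exact: sub_finite_set S0s _.
exists (undup u); have uE : S0 = [set` undup u].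
  by rewrite S0E; apply/seteqP; split=> x /=; rewrite mem_undup.
split=> //; first exact: undup_uniq.
- by apply: ind_of_independent; rewrite ?undup_uniq// -uE.
- by move=> x; have := S0s x; rewrite uE.
- by rewrite /adjoin -uE.
Qed.

(** A shortest spanning sequence from [s] is independent, because a dependent entry could be
    deleted. *)
Lemma basis_exists B s : exists S0, is_basis_over cl B [set` s] S0.
Proof.
pose spans k := `[< exists t, [/\ size t = k, {subset t <= s} &
  [set` s] `<=` cl (adjoin B t)] >].
have exS : exists k, spans k.
  exists (size s); apply/asboolP; exists s; split=> // x xs.
  by apply: cl_ext; left.
case: (ex_minnP exS) => k /asboolP[t [tk ts st]] kmin.
exists [set` t]; split=> // x xt clx.
pose t' := [seq y <- t | y != x].
have t'E : [set` t] `\ x = [set` t'].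
  apply/seteqP; split=> y /=; rewrite mem_filter.
    by move=> [yt /eqP yx]; rewrite yx.
  by move=> /andP[/eqP].
rewrite t'E in clx.
have : spans (size t').
  apply/asboolP; exists t'; split=> //.
    by move=> y; rewrite mem_filter => /andP[_ /ts].
  move=> y /st; apply: cl_trans => z [/= zt|zB]; last by apply: cl_ext; right.
  have [->//|zx] := eqVneq z x.
  by apply: cl_ext; left; rewrite /= mem_filter zx.
move=> /kmin; rewrite -tk leqNgt size_filter -(count_predC (fun y => y != x) t).
rewrite -[X in (X < _)%N]addn0 ltn_add2l -has_count => /negP; apply.
by apply/hasP; exists x => //=; rewrite negbK.
Qed.

Lemma is_rk_size B s t : {subset t <= s} -> uniq t -> ind B t ->
  [set` s] `<=` cl (adjoin B t) -> is_rk cl B [set` s] (size t).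
Proof.
move=> ts ut indt spant; split; first exact: basis_exists.
move=> S0 /(basis_seq erefl)[u [uu -> indu us spanu]].
suff -> : size t = size u by exact: card_set_seq.
have tu := steinitz indt (fun x xt => spanu x (ts x xt)).
have ut' := steinitz indu (fun x xu => spant x (us x xu)).
by apply/eqP; rewrite eqn_leq tu.
Qed.

Lemma rk_seqP B s : exists t, [/\ {subset t <= s}, uniq t, ind B t,
  [set` s] `<=` cl (adjoin B t) & is_rk cl B [set` s] (size t)].
Proof.
have [S0 /(basis_seq erefl)[t [ut _ indt ts spant]]] := basis_exists B s.
by exists t; split=> //; exact: is_rk_size.
Qed.

Section Tuples.
Variables (B : set U) (n : nat) (a : 'I_n -> U).

Let rangeE : range a = [set` codom a].
Proof.
apply/seteqP; split=> [_ [i _ <-]|x /codomP[i ->]]; first exact: codom_f.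
by exists i.
Qed.

Lemma is_rk_exists : exists2 k, is_rk cl B (range a) k & (k <= n)%N.
Proof.
rewrite rangeE; have [t [ts _ indt _ rkt]] := rk_seqP B (codom a).
exists (size t) => //; rewrite -[n in (_ <= n)%N]card_ord -(size_codom a).
apply: steinitz indt _ => x /ts xa; by apply: cl_ext; left.
Qed.

Lemma is_rk_ge m (s : 'I_m -> 'I_n) k :
  is_rk cl B (range a) k -> ind B (codom (a \o s)) -> (m <= k)%N.
Proof.
rewrite rangeE => rk inds; have [t [_ _ _ spant rkt]] := rk_seqP B (codom a).
rewrite (is_rk_unique rk rkt) -[m]card_ord -(size_codom (a \o s)).
by apply: steinitz inds _ => x /codomP[i ->]; apply: spant; exact: codom_f.
Qed.

(** The elements of a basis are lifted to indices, which are then sorted to make the coordinate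
    selection increasing. *)
Lemma is_rk_independent_coordinates k : is_rk cl B (range a) k ->
  exists2 s : 'I_k -> 'I_n, {homo s : i j / (i < j)%N} & ind B (codom (a \o s)).
Proof.
rewrite rangeE => -[[S0 bS0] /(_ _ bS0) cardS0].
have [t [ut S0E _ ts _]] := basis_seq erefl bS0.
have kt : k = size t.
  by apply/card_eq_II; rewrite -(card_eql cardS0) S0E card_set_seq.
have [J aJ] : exists J : seq 'I_n, map a J = t.
  elim: t ts {ut S0E kt} => [|x t IH] ts; first by exists [::].
  have [|J <-] := IH; first by move=> y yt; apply: ts; rewrite inE yt orbT.
  have /codomP[i ->] : x \in codom a by apply: ts; exact: mem_head.
  by exists (i :: J).
pose J' := sort (fun i j : 'I_n => i <= j)%N J.
have memJ : J' =i J by move=> i; rewrite mem_sort.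
have size_J' : size J' == k by rewrite size_sort kt -aJ size_map.
have uJ : uniq J by apply: (@map_uniq _ _ a); rewrite aJ.
have sJ : sorted ltn (map val J').
  rewrite ltn_sorted_uniq_leq map_inj_uniq ?sort_uniq ?uJ//=; last exact: val_inj.
  rewrite sorted_map; apply: sort_sorted => i j; exact: leq_total.
pose s i := tnth (Tuple size_J') i.
have codom_s : codom (a \o s) = map a J'.
  by rewrite codomE map_comp (map_tnth_enum (Tuple size_J')).
exists s => [i j ij|].
  have si l : val (s l) = nth 0 (map val J') l.
    rewrite /s (tnth_nth (s l)) (nth_map (s l)) ?(eqP size_J')//.
  rewrite (si i) (si j).
  by apply: (sorted_ltn_nth ltn_trans) => //; rewrite inE size_map (eqP size_J').
have bE : [set` map a J'] = S0.
  rewrite S0E -aJ; apply/seteqP; split=> x /= /mapP[i iJ ->]; apply: map_f.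
    by rewrite -memJ.
  by rewrite memJ.
rewrite codom_s; apply: ind_of_independent; last by rewrite bE; case: bS0.
have p : perm_eq (map a J') (map a J) by apply: perm_map; rewrite perm_sort.
by rewrite (perm_uniq p) aJ.
Qed.

End Tuples.
End Matroid.

(** * The discrete closure *)

Lemma fun_ord1 (U : Type) (x : 'I_1 -> U) : (fun=> x ord0) = x.
Proof. by apply: funext => i; rewrite ord1. Qed.

Section Smallness.
Variable K : Type.
Hypothesis K_uncountable : small K [set: nat].

Lemma small_sub (U V : Type) (A : set U) (B : set V) :
  A #<= B -> small K B -> small K A.
Proof. by move=> AB nB KA; apply: nB; exact: card_le_trans KA AB. Qed.

(** Hilbert's hotel: along an injected copy of the naturals, [h] shifts back by one and sends the
    first point to [x]. *)
Lemma infinite_setU1_card_le (U : Type) (A : set U) x :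
  ~ finite_set A -> x |` A #<= A.
Proof.
elim/Ppointed: U => U in A x *; first by case: (no x).
move=> /infiniteP/pcard_leP[f].
have finj i j : f i = f j -> i = j by move=> /inj; apply; exact: in_setT.
pose h y := if pselect (exists i, y = f i) is left e then
  (if sval (cid e) is i.+1 then f i else x) else y.
have hf i : h (f i) = if i is k.+1 then f k else x.
  rewrite /h; case: pselect => [e|[]]; last by exists i.
  by rewrite -(finj _ _ (svalP (cid e))).
have hA : x |` A `<=` h @` A.
  move=> y [->|Ay]; first by exists (f 0); [exact: funS|rewrite hf].
  have [[i ->]|yf] := pselect (exists i, y = f i).
    by exists (f i.+1); [exact: funS|rewrite hf].
  by exists y => //; rewrite /h; case: pselect.
exact: card_le_trans (subset_card_le hA) (card_image_le h A).
Qed.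

Lemma small_setU1 (U : Type) (A : set U) x : small K A -> small K (x |` A).
Proof.
move=> sA; have [finA|infA] := pselect (finite_set A); last first.
  exact: small_sub (infinite_setU1_card_le x infA) sA.
apply: small_sub K_uncountable.
by apply: finite_set_countable; rewrite finite_setU; split=> //; exact: finite_set1.
Qed.

Lemma small_adjoin (U : eqType) (A : set U) s : small K A -> small K (adjoin A s).
Proof.
move=> sA; elim: s => [|x s IH]; first by rewrite adjoin_nil.
by rewrite adjoin_cons; exact: small_setU1.
Qed.

End Smallness.

Section DiscreteClosure.
Variables (L : language) (N : structure L).
Hypothesis T : tame (@less L N).
Implicit Types (B C X : set N) (a b x : N).

Let dlo := tame_dlo T.
Let ne := tame_no_endpoints T.

Let to_top B V (P : set (V -> N)) : dset B P -> dset [set: N] P.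
Proof. exact: dset_mono. Qed.

Lemma thin_set1 x : thin (@less L N) [set x].
Proof.
move=> a b ab; have [z [az zb]] := dlo_dense dlo ab.
have [y [ay yz]] := dlo_dense dlo az.
have [xz|nxz] := pselect (z = x); last by exists z.
exists y; split=> //; first exact: dlo_trans dlo _ _ _ yz zb.
by move=> /= yx; move: yz; rewrite xz yx; exact: dlo_irrefl.
Qed.

(** A point of an interval is never isolated in it, so a discrete set is thin. Conversely, a thin
    definable set leaves a gap on both sides of every point, whether in the set or not. *)
Lemma disclP B x :
  discl B x <-> exists X, [/\ def1 B X, thin (@less L N) X & X x].
Proof.
split=> [[phi /= [discD _ Dx]]|[X [[phi phiE] tX Xx]]].
  exists [set y | defined_in id phi (fun=> y)]; split=> //.
    apply: dfn_ext ((dset_definedP B (defined_in id phi)).2 _); last by exists phi.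
    by move=> _ v /=; rewrite fun_ord1.
  apply: contrapT => /(not_thinP dlo)[a [b [ab abD]]].
  have [y [ay yb]] := dlo_dense dlo ab.
  have [O [oO ODE]] := discD y (abD y ay yb).
  have [Oy _] : (O `&` [set y | defined_in id phi (fun=> y)]) y by rewrite ODE.
  have [p [q [pyq pqO]]] := oO y Oy.
  apply: (near_not_thin dlo _ (@thin_set1 y)).
  apply: near_mono (near_and dlo (near_between ay yb) (near_interval ne pyq)).
  by move=> z [[az zb] /pqO Oz]; rewrite -ODE; split=> //; exact: abD.
have dX : def1 [set: N] X by apply: (@to_top B); exists phi.
have XE y : defined_in id phi (fun=> y) = X y.
  by apply/propext; split=> [/(phiE tt)|Xy]; last exact/(phiE tt).
exists phi; cbv zeta; rewrite (_ : [set y | _] = X); last exact/funext.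
have isolated y : exists p q, [/\ less p y, less y q &
    forall z, X z -> interval (@less L N) (Some p) (Some q) z -> z = y].
  have [p py pX] := thin_gap_below y T dX tX.
  have [q yq qX] := thin_gap_above T y dX tX.
  exists p, q; split=> // z Xz [pz zq].
  by have [/(pX z pz)|[//|/qX/(_ zq)]] := dlo_total dlo z y.
split=> // y Xy; have [p [q [py yq pqX]]] := isolated y; last first.
  exists (Some p), (Some q); split=> // z pzq Xz; apply: Xy.
  by rewrite -(pqX z Xz pzq).
exists (interval (@less L N) (Some p) (Some q)); split.
  by move=> z pzq; exists (Some p), (Some q); split.
by apply/seteqP; split=> [z [pzq Xz]|_ ->//]; exact: pqX.
Qed.

Lemma discl_ext B : B `<=` discl B.
Proof.
move=> x Bx; apply/disclP; exists [set x]; split=> //; last exact: thin_set1.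
by rewrite /set1 /mkset; cbv beta; dfn_tac.
Qed.

Lemma discl_mono B C : B `<=` C -> discl B `<=` discl C.
Proof.
move=> BC x /disclP[X [dX tX Xx]]; apply/disclP; exists X; split=> //.
exact: dset_mono dX.
Qed.

Lemma def1_instance B b X : def1 (b |` B) X ->
  exists R : N -> set N, def2 B R /\ X = R b.
Proof.
move=> /dset_instance[Q [dQ QE]].
exists (fun e x => Q (oext (fun=> x) e)); split.
  pose f (o : option 'I_1) (t : unit) (v : 'I_2 -> N) :=
    if o is Some _ then v ord_max else v ord0.
  apply: dfn_ext (dfn_app (f := f) dQ _) => [t v /=|[i|]]; try exact: dtm_var.
  by rewrite /oext (_ : (fun o => f o t v) =
    (fun o => if o is Some _ then v ord_max else v ord0)) //.
by apply/funext => x; apply/propext; exact: (QE (fun=> x)).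
Qed.

Lemma def1_fibre B b (R : N -> set N) : def2 B R -> def1 (b |` B) (R b).
Proof.
move=> dR; have dR' : def2 (b |` B) R by apply: dset_mono dR; exact: subsetUr.
have Bb : (b |` B) b by left.
by dfn_tac.
Qed.

Lemma discl_step B a b : discl (b |` B) a -> discl B b -> discl B a.
Proof.
move=> /disclP[X [/def1_instance[R [dR ->]] tRb Rba]] /disclP[E [dE tE Eb]].
apply/disclP.
(* Keeping only the [e] with thin fibre is a definable restriction, and [b] satisfies it. *)
exists [set x | exists e, [/\ E e, thin (@less L N) (R e) & R e x]].
split; last by exists b.
  by rewrite /thin /mkset; cbv beta; dfn_tac.
have dE' := to_top dE; have dR' := to_top dR.
pose E' e := E e /\ thin (@less L N) (R e).
have dE'' : def1 [set: N] E' by rewrite /E' /thin; cbv beta; dfn_tac.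
have tE' : thin (@less L N) E' by apply: thin_sub tE => e [].
apply: thin_sub (thin_union_fibres T dE'' tE' dR' _) => [x [e [Ee tRe Rex]]|e []//].
by exists e.
Qed.

(** A formula uses finitely many parameters, which [discl_step] removes one by one. *)
Lemma discl_idem B : discl (discl B) `<=` discl B.
Proof.
move=> x /disclP[X [dX tX Xx]].
have [B0 [finB0 B0B dB0]] := dset_finite_params dX.
have : discl (B0 `|` B) x.
  by apply/disclP; exists X; split=> //; apply: dset_mono dB0; exact: subsetUl.
move: B0B x {X dX tX Xx dB0}.
have := finB0; move: B0 {finB0}; apply: finite_set_induction => [_ x|b F IH bFB x].
  by rewrite set0U.
have FB : F `<=` discl B by move=> y Fy; apply: bFB; right.
rewrite -setUA => /discl_step xb; apply: (IH FB); apply: xb.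
by apply: (discl_mono (@subsetUr _ F B)); apply: bFB; left.
Qed.

Lemma discl_exchange B a b : discl (b |` B) a -> ~ discl B a -> discl (a |` B) b.
Proof.
move=> /disclP[X [/def1_instance[R [dR ->]] tRb Rba]] na.
(* Only the fibre of [R] over [b] is known to be thin; discarding the other kind of fibre makes all
   sections of [Y] at a fixed [y] thin. *)
pose Y x y := R y x /\ thin (@less L N) (R y).
have dY : def2 B Y by rewrite /Y /thin; cbv beta; dfn_tac.
have tY y : thin (@less L N) [set x | Y x y].
  have [tR|nt] := pselect (thin (@less L N) (R y)).
    by apply: thin_sub tR => x [].
  by apply: thin_sub (@thin_set1 y) => x [].
apply/disclP; exists (Y a); split=> //; first exact: def1_fibre.
apply: contrapT => ntYa; apply: na; apply/disclP.
exists [set x | ~ thin (@less L N) (Y x)]; split=> //.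
  by rewrite /thin /mkset; cbv beta; dfn_tac.
exact: (thin_not_thin_fibres T (to_top dY) tY).
Qed.

(** The non-interior points of [X] form a thin set definable over [B]: an interval of them would
    consist of interior points. *)
Lemma near_of_not_discl B X x : def1 B X -> X x -> ~ discl B x ->
  near (@less L N) x X.
Proof.
move=> dX Xx; apply: contra_notP => nx; apply/disclP.
exists [set y | X y /\ ~ near (@less L N) y X]; split=> //.
  by rewrite /near /mkset; cbv beta; dfn_tac.
apply: contrapT => /(not_thinP dlo)[a [b [ab abX]]].
have [y [ay yb]] := dlo_dense dlo ab; have [_] := abX y ay yb; apply.
by exists a, b; split=> // z az zb; have [] := abX z az zb.
Qed.

(** * Generic points by saturation *)

Section Saturation.
Variable K : Type.
Hypotheses (K_uncountable : small K [set: nat]) (satN : saturated K N).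

(** The relevant type is finitely satisfiable because a finite union of thin definable sets is thin
    and so does not cover the interval. *)
Lemma generic_point B a b : small K B -> less a b ->
  exists x, [/\ less a x, less x b & ~ discl B x].
Proof.
move=> sB ab; pose B' := a |` (b |` B).
have sB' : small K B' by do 2! apply: small_setU1 => //.
pose bad (phi : formula_over B' 'I_1) :=
  [set z | [/\ less a z, less z b & ~ defined_in id phi (fun=> z)]].
have B'a : B' a by left.
have B'b : B' b by right; left.
have dbad phi : def1 B' (bad phi).
  rewrite /bad /mkset; cbv beta; apply: dfn_and3; [by dfn_tac|by dfn_tac|].
  apply: dfn_not; apply: dfn_ext ((dset_definedP B' (defined_in id phi)).2 _).
    by move=> _ v /=; rewrite fun_ord1.
  by exists phi.
(* The type consists of the formulas that fail only on a thin part of the interval. It covers both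
   the bounds [a], [b] and the complements of thin sets definable over [B]. *)
pose p : set (formula_over B' 'I_1) := [set phi | thin (@less L N) (bad phi)].
have fin_sat q : finite_set q -> q `<=` p ->
    exists x : 'I_1 -> N, forall phi, q phi -> defined_in id phi x.
  move=> finq qp.
  have : thin (@less L N) (\bigcup_(phi in q) bad phi).
    move: qp; have := finq; move: q {finq}.
    apply: finite_set_induction => [_|phi q IH qp].
      by rewrite bigcup_set0; apply: thin_sub (@thin_set1 a).
    rewrite bigcup_setU bigcup_set1; apply: (thin_union T).
    - exact: to_top.
    - by apply: qp; left.
    - by apply: IH => psi qpsi; apply: qp; right.
  move=> /(_ _ _ ab)[x [ax xb nx]]; exists (fun=> x) => phi qphi.
  by apply: contrapT => nphi; apply: nx; exists phi.
have [x xp] := satN sB' fin_sat.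
have realized (P : set N) : def1 B' P ->
    thin (@less L N) [set z | [/\ less a z, less z b & ~ P z]] -> P (x ord0).
  move=> [phi phiE] tP; apply/(phiE tt); apply: xp.
  apply: thin_sub tP => z [az zb nz]; split=> // Pz; apply: nz.
  exact: ((phiE tt (fun=> z)).1 Pz).
have thin_empty (P : set N) : (forall z, less a z -> less z b -> P z) ->
    thin (@less L N) [set z | [/\ less a z, less z b & ~ P z]].
  by move=> abP; apply: thin_sub (@thin_set1 a) => z [az zb []]; exact: abP.
exists (x ord0); split.
- by apply: (realized (less a)); [dfn_tac|exact: thin_empty].
- by apply: (realized [set z | less z b]);
    [rewrite /mkset; cbv beta; dfn_tac|exact: thin_empty].
- move=> /disclP[X [dX tX]]; apply: (realized (~` X)).
    apply: dfn_not; apply: dset_mono dX => y By; by right; right.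
  by apply: thin_sub tX => z [_ _ /contrapT].
Qed.

End Saturation.
End DiscreteClosure.

(** * Boxes *)

(** The corners are points of the structure, so the notion is first-order. For [d] equal to zero it
    says that [Z] is nonempty. *)
Definition has_box (L : language) (N : structure L) d (Z : set ('I_d -> N)) :=
  exists a b : 'I_d -> N, (forall i, less (a i) (b i)) /\
    forall y, (forall i, less (a i) (y i) /\ less (y i) (b i)) -> Z y.

Lemma oconsE m (U : Type) (x : 'I_m.+1 -> U) :
  x = ocons (x ord0) (x \o lift ord0).
Proof. by apply: funext => i; rewrite /ocons; case: unliftP => [k|] ->. Qed.

Lemma ocons0 m (U : Type) x0 (x : 'I_m -> U) : ocons x0 x ord0 = x0.
Proof. by rewrite /ocons unlift_none. Qed.

Lemma oconsS m (U : Type) x0 (x : 'I_m -> U) i : ocons x0 x (lift ord0 i) = x i.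
Proof. by rewrite /ocons liftK. Qed.

Lemma codom_ordS m (U : Type) (x : 'I_m.+1 -> U) :
  codom x = x ord0 :: codom (x \o lift ord0).
Proof. by rewrite !codomE enum_ordSl /= -map_comp. Qed.

Section Boxes.
Variables (L : language) (N : structure L) (K : Type).
Hypothesis T : tame (@less L N).
Hypotheses (K_uncountable : small K [set: nat]) (satN : saturated K N).

Let dlo := tame_dlo T.
Local Notation U := {classic N}.
Local Notation dind := (@ind U (@discl L N)).

Lemma box_of_ind d B (Z : set ('I_d -> N)) (z : 'I_d -> U) :
  small K B -> dset B Z -> Z z -> dind B (codom z) -> has_box Z.
Proof.
elim: d B Z z => [|d IH] B Z z sB dZ Zz.
  move=> _; exists z, z; split=> [[]//|y _].
  by rewrite (_ : y = z) //; apply/funext => -[].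
rewrite codom_ordS => -[nz0 indz'].
set z' := z \o lift ord0 in nz0 indz'.
set C : set N := @adjoin U B (codom z') in nz0.
have dF : def1 C [set y | Z (ocons y z')].
  have BC : B `<=` C by move=> y By; right.
  pose f i (t : unit) (v : 'I_1 -> N) : N := ocons (v ord0) z' i.
  apply: (dfn_app (f := f) (dset_mono BC dZ)) => i; rewrite /f /ocons.
  case: (unlift ord0 i) => [k|]; last exact: dtm_var.
  by apply: dtm_const; left; exact: codom_f.
have Fz0 : [set y | Z (ocons y z')] (z ord0) by rewrite /= /z' -oconsE.
have [p0 [q0 [pz0 zq0 pqF]]] := near_of_not_discl T dF Fz0 nz0.
have sC : small K C by exact: (@small_adjoin K K_uncountable U).
(* The corners [p0] and [q0] are replaced by generic ones closer to [z ord0], so that the remaining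
   coordinates stay independent over them. *)
have [p [p0p pz np]] := generic_point T K_uncountable satN sC pz0.
have [q [zq qq0 nq]] :=
  generic_point T K_uncountable satN (small_setU1 (x := p) K_uncountable sC) zq0.
pose B' : set N := q |` (p |` B).
have sB' : small K B' by do 2! apply: small_setU1 => //.
have indp : dind (p |` B) (codom z').
  exact: (@ind_setU1 U _ (@discl_mono L N T) (@discl_exchange L N T)).
have indq : dind B' (codom z').
  apply: (@ind_setU1 U _ (@discl_mono L N T) (@discl_exchange L N T)) => //.
  by rewrite adjoin_setU1.
have B'p : B' p by right; left.
have B'q : B' q by left.
have BB' : B `<=` B' by move=> y By; right; right.
pose Z' (x : 'I_d -> N) := forall y, less p y -> less y q -> Z (ocons y x).
have dZ' : dset B' Z'.
  apply: dfn_all; apply: dfn_imp; first by dfn_tac.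
  apply: dfn_imp; first by dfn_tac.
  pose f i (t : unit) (w : option 'I_d -> N) : N :=
    ocons (w None) (fun k => w (Some k)) i.
  apply: (dfn_app (f := f) (dset_mono BB' dZ)) => i; rewrite /f /ocons.
  by case: (unlift ord0 i) => [k|]; exact: dtm_var.
have Z'z' : Z' z'.
  move=> y py yq; apply: pqF; first exact: dlo_trans dlo _ _ _ p0p py.
  exact: dlo_trans dlo _ _ _ yq qq0.
have [a [b [ab abZ']]] := IH _ _ _ sB' dZ' Z'z' indq.
exists (ocons p a), (ocons q b); split=> [i|y aby].
  case: (unliftP ord0 i) => [k|] ->; rewrite ?oconsS ?ocons0//.
  exact: dlo_trans dlo _ _ _ pz zq.
rewrite (oconsE y); apply: abZ' => [i||].
- by have := aby (lift ord0 i); rewrite !oconsS.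
- by have := aby ord0; rewrite !ocons0 => -[].
- by have := aby ord0; rewrite !ocons0 => -[].
Qed.

(** Coordinates are chosen from the last to the first, each generic over the later ones, matching
    the order in [ind]. *)
Lemma ind_of_box d B (a b : 'I_d -> N) : small K B ->
  (forall i, less (a i) (b i)) -> exists z : 'I_d -> U,
    (forall i, less (a i) (z i) /\ less (z i) (b i)) /\ dind B (codom z).
Proof.
move=> sB; elim: d a b => [|d IH] a b ab.
  by exists a; split=> [[]//|]; rewrite codomE enum_ord0.
have [z [abz indz]] := IH _ _ (fun i => ab (lift ord0 i)).
have sC : small K (@adjoin U B (codom z)).
  exact: (@small_adjoin K K_uncountable U).
have [z0 [az0 z0b nz0]] := generic_point T K_uncountable satN sC (ab ord0).
exists (ocons z0 z); split=> [i|].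
  by case: (unliftP ord0 i) => [k|] ->; rewrite ?oconsS ?ocons0//; exact: abz.
rewrite codom_ordS ocons0 (_ : _ \o _ = z) //.
by apply: funext => i /=; rewrite oconsS.
Qed.

End Boxes.

Section InteriorBoxes.
Variables (L : language) (N : structure L).
Hypotheses (dlo : expands_dlo N).

Lemma prod_interior_box d (Z : set ('I_d -> N)) :
  prod_interior (@less L N) Z !=set0 <-> has_box Z.
Proof.
have [ord ne] := dlo; split=> [[x [O [oO Ox OZ]]]|[a [b [ab abZ]]]].
  have [a [b [abx abO]]] := oO x Ox.
  have /choice[c cP] := fun i => near_interval ne (abx i).
  have /choice[e eP] := cP.
  exists c, e; split=> [i|y cey].
    by have [cx xe _] := eP i; exact: dlo_trans ord _ _ _ cx xe.
  by apply/OZ/abO => i; have [_ _] := eP i; apply; have [] := cey i.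
have /choice[x xP] := fun i => dlo_dense ord (ab i).
exists x, [set y | forall i, less (a i) (y i) /\ less (y i) (b i)]; split=> //.
move=> y aby; exists (Some \o a), (Some \o b); split=> [i|z]; last exact.
exact: aby.
Qed.

Lemma proj_interiorP n d (X : set ('I_n -> N)) :
  proj_interior_nonempty X d <->
  exists2 s : 'I_d -> 'I_n, {homo s : i k / (i < k)%N} &
    has_box [set x \o s | x in X].
Proof.
by split=> -[s hs bs]; exists s => //; apply/prod_interior_box.
Qed.

Lemma has_box_nonempty n (X : set ('I_n -> N)) (s : 'I_0 -> 'I_n) :
  has_box [set x \o s | x in X] <-> X !=set0.
Proof.
split=> [[a [b [_ abX]]]|[x Xx]].
  by have [|x Xx _] := abX a; [case|exists x].
exists (x \o s), (x \o s); split=> [[]//|y _]; exists x => //.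
by apply: funext => -[].
Qed.

End InteriorBoxes.

(** * Transfer along an elementary embedding *)

Section Transfer.
Variables (L : language) (M N : structure L) (j : M -> N).
Hypothesis j_elem : elementary_embedding j.

(** The finitely many variables that occur are numbered, which reduces to the variable types
    ['I_k]. *)
Lemma elementary_sat (V : Type) (phi : formula L V) (x : V -> M) :
  sat x phi <-> sat (j \o x) phi.
Proof.
have [F /(@finite_seqP {classic V})[s FE] [psi ->]] := formula_finite_support phi.
have Fs i : F i -> (i : {classic V}) \in s by rewrite FE.
have idx (u : {i | F i}) : (index (sval u : {classic V}) s < size s)%N.
  by rewrite index_mem Fs//; exact: svalP.
pose r u : 'I_(size s) := Ordinal (idx u).
pose e (i : 'I_(size s)) : V := tnth (in_tuple s) i.
have er u : e (r u) = sval u.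
  rewrite /e (tnth_nth (sval u : {classic V})) /= nth_index//.
  by rewrite Fs//; exact: svalP.
have satE (Q : structure L) (y : V -> Q) :
    sat y (fren sval psi) = sat (y \o e) (fren r psi).
  by rewrite !sat_ren; congr sat; apply: funext => u /=; rewrite er.
by rewrite !satE; exact: j_elem.
Qed.

Lemma elementary_holds (phi : sentence L) : holds M phi <-> holds N phi.
Proof.
by rewrite /holds elementary_sat; apply: sat_ext => -[].
Qed.

Variables (A : set M) (n : nat) (phi : formula_over A 'I_n).

Lemma has_box_transfer m (s : 'I_m -> 'I_n) :
  has_box [set x \o s | x in defined_in id phi] <->
  has_box [set x \o s | x in defined_in j phi].
Proof.
(* In the family of the two structures one formula expresses the box condition in both; elementarity
   then applies with the parameters as variables. *)
pose N_ (t : bool) := if t then N else M.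
pose j_ (t : bool) : M -> N_ t := if t is true then j else id.
pose c_ (t : bool) (c : {c | A c}) : N_ t := j_ t (sval c).
pose P (t : bool) (v : void -> N_ t) := exists a b : 'I_m -> N_ t,
  (forall i, less (a i) (b i)) /\ forall y : 'I_m -> N_ t,
    (forall i, less (a i) (y i) /\ less (y i) (b i)) ->
    exists x : 'I_n -> N_ t, sat (passign c_ x) phi /\ forall i, x (s i) = y i.
have dP : dfn c_ P.
  apply: dfn_ex_tuple; apply: dfn_ex_tuple; apply: dfn_and.
    by apply: dfn_all_ord => i; apply: dfn_less; exact: dtm_var.
  apply: dfn_all_tuple; apply: dfn_imp.
    by apply: dfn_all_ord => i; apply: dfn_and; apply: dfn_less; exact: dtm_var.
  apply: dfn_ex_tuple; apply: dfn_and.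
    have dphi : dfn c_ (fun t (x : 'I_n -> N_ t) => sat (passign c_ x) phi).
      by exists phi.
    apply: (dfn_app (f := fun i t w => w (inl i)) dphi) => i; exact: dtm_var.
  by apply: dfn_all_ord => i; apply: dfn_eq; exact: dtm_var.
have boxE t : has_box [set x \o s | x in defined_in (j_ t) phi] <->
    P t (@of_void _).
  split=> -[a [b [ab abZ]]]; exists a, b; split=> // y /abZ.
    by move=> [x phix <-]; exists x.
  by move=> [x [phix xy]]; exists x => //; apply: funext => i; exact: xy.
have [psi psiE] := dP.
rewrite (boxE false) (boxE true) !psiE elementary_sat.
by apply: sat_ext => -[[]|c].
Qed.

Lemma dset_embedded : dset (j @` A) (defined_in j phi).
Proof.
pose r (s : 'I_n + {c | A c}) : 'I_n + {x | (j @` A) x} :=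
  match s with
  | inl i => inl i
  | inr c => inr (exist _ (j (sval c)) (imageP j (svalP c)))
  end.
exists (fren r phi) => t v; rewrite sat_ren.
by apply: sat_ext => -[].
Qed.

End Transfer.

(** * Dimension and rank *)

Lemma dset_proj (L : language) (N : structure L) (B : set N) m n
    (s : 'I_m -> 'I_n) (X : set ('I_n -> N)) :
  dset B X -> dset B [set x \o s | x in X].
Proof.
move=> dX; apply: (dfn_ext (P := fun _ (v : 'I_m -> N) =>
  exists x, X x /\ forall i, x (s i) = v i)).
  move=> _ v; split=> [[x [Xx xv]]|[x Xx <-]]; exists x => //.
  by apply: funext => i; exact: xv.
apply: dfn_ex_tuple; apply: dfn_and.
  by apply: (dfn_app (f := fun i t w => w (inl i)) dX) => i; exact: dtm_var.
by apply: dfn_all_ord => i; apply: dfn_eq; exact: dtm_var.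
Qed.

(** The dimension is the greatest rank [k] of a tuple of [XN]: its [k] independent coordinates give
    a box in a projection, and an independent point of a box in any projection lifts to a tuple of
    at least that rank. *)
Lemma dim_eq_discl_rank (L : language) (K : Type) (M N : structure L)
    (j : M -> N) (A : set M) n (phi : formula_over A 'I_n) :
  expands_dlo M -> tame (@less L N) -> small K [set: nat] -> saturated K N ->
  small K [set: M] -> elementary_embedding j ->
  exists d, is_dim (defined_in id phi) d /\ is_discl_rank j phi d.
Proof.
move=> dloM T Kunc satN sM j_elem.
have dloN : expands_dlo N by split; [exact: tame_dlo T|exact: tame_no_endpoints T].
set X := defined_in id phi; set XN := defined_in j phi; pose B := j @` A.
have sB : small K B.
  apply: small_sub sM; apply: card_le_trans (card_image_le j A) _.
  exact: card_leT.
have ext := @discl_ext L N T; have mono := @discl_mono L N T.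
have idem := @discl_idem L N T; have exch := @discl_exchange L N T.
have boxE m (s : 'I_m -> 'I_n) := has_box_transfer j_elem phi s.
have nonemptyE : X !=set0 <-> XN !=set0.
  (* Nonemptiness is the case of the projection to zero coordinates. *)
  pose s (i : 'I_0) : 'I_n := False_rect _ (notF (ltn_ord i)).
  by rewrite -!(has_box_nonempty _ s); exact: boxE.
have [[a0 XNa0]|XN0] := pselect (XN !=set0); last first.
  exists None; split; apply/seteqP; split=> // x Xx; case: XN0; last by exists x.
  by apply/nonemptyE; exists x.
have rk_exists a := @is_rk_exists {classic N} _ ext mono idem exch B n a.
pose is_rank k := `[< exists2 a, XN a & is_rk (@discl L N) B (range a) k >].
have ex_rank : exists k, is_rank k.
  by have [k rk _] := rk_exists a0; exists k; apply/asboolP; exists a0.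
have rank_le k : is_rank k -> (k <= n)%N.
  move=> /asboolP[a _ rk]; have [m rm mn] := rk_exists a.
  by rewrite (is_rk_unique rk rm).
case: (ex_maxnP ex_rank rank_le) => k /asboolP[a XNa rka] kmax.
exists (Some k); split; split.
- by apply/nonemptyE; exists a.
- have [s hs inds] := @is_rk_independent_coordinates {classic N} _ mono B n a k rka.
  apply/(proj_interiorP dloM); exists s => //; apply/boxE.
  apply: (box_of_ind T Kunc satN sB _ _ inds); last by exists a.
  by apply: dset_proj; exact: dset_embedded.
- move=> m /(proj_interiorP dloM)[s hs /boxE[b [c [bc bcX]]]].
  have [z [bcz indz]] := ind_of_box T Kunc satN sB bc.
  have [a' XNa' a'z] := bcX z bcz.
  have [l rkl _] := rk_exists a'.
  apply: (@leq_trans l); last by apply: kmax; apply/asboolP; exists a'.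
  apply: (@is_rk_ge {classic N} _ ext mono idem exch B n a' m s l rkl).
  by rewrite (_ : _ \o s = z).
- by exists a.
- move=> a' XNa'; have [l rkl _] := rk_exists a'; exists l => //.
  by apply: kmax; apply/asboolP; exists a'.
Qed.

Theorem theorem4p32 (L : language) (T : set (sentence L))
    (T_complete : complete_theory T)
    (T_models : forall N : structure L, is_model N T ->
       [/\ expands_dlo N, star_locally_weakly_o_minimal N &
           univariate_star_continuity N])
    (K : Type) (MM : structure L) (MM_monster : monster K MM)
    (M : structure L) (M_model : is_model M T) (M_small : small K (@setT M))
    (j : M -> MM) (j_elem : elementary_embedding j)
    (n : nat) (X : set ('I_n -> M))
    (A : set M) (phi : formula_over A 'I_n) (X_def : X = defined_in id phi) :
  exists d : option nat,
    [/\ is_dim X d,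
        is_discl_rank j phi d &
        forall (A' : set M) (phi' : formula_over A' 'I_n),
          X = defined_in id phi' -> is_discl_rank j phi' d].
Proof.
have [dloM _ _] := T_models M M_model.
have MM_model : is_model MM T.
  by move=> psi /M_model; apply: (elementary_holds j_elem _).1.
have [dloMM swom scont] := T_models MM MM_model.
have tameMM := tame_less dloMM swom scont.
have [K_uncountable _ _ satMM _] := MM_monster.
have dim_rank A' (phi' : formula_over A' 'I_n) :=
  dim_eq_discl_rank phi' dloM tameMM K_uncountable satMM M_small j_elem.
have [d [dimd rkd]] := dim_rank A phi.
exists d; split=> //; first by rewrite X_def.
(* The dimension depends on the set alone, so its uniqueness identifies the ranks over [A] and
   [A']. *)
move=> A' phi' X_def'; have [e [dime rke]] := dim_rank A' phi'.
rewrite -X_def in dimd; rewrite -X_def' in dime.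
by rewrite (is_dim_unique dimd dime).
Qed.
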